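(* Let $H=\{H_\alpha\}_{\alpha\in G}$ be a Hopf $G$-coalgebra with bijective antipode, $A=\{A_\alpha\}_{\alpha\in G}$ a right $H$-comodule Poisson algebra, $M$ a Poisson $(A,H)$-Hopf module, and $\phi:H\rightarrow A^A$ a right $H$-colinear algebra map. Put $B=A^{AcoH}$. Suppose that $M^{coH}$ and $A^{coH}$ are trivial Lie $A_e$-modules under $\diamond'$. Then the map $\Phi=\{\Phi_\alpha\}_{\alpha\in G}:A\otimes_B M^{AcoH}\rightarrow M$, $$\Phi_\alpha:A_\alpha\otimes_{B_\alpha}M^{AcoH}_\alpha\to M_\alpha,\qquad \Phi_\alpha(a\otimes_{B_\alpha} m_\alpha)=a\cdot m_\alpha,$$ is an isomorphism of Poisson $(A,H)$-Hopf modules.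
   Context: $k$ is a field; all vector spaces, tensor products and maps are over $k$ unless indicated. $G$ is an abelian group with unit $e$. Hopf $G$-coalgebra: a family $H=\{H_\alpha\}_{\alpha\in G}$ of algebras with algebra maps $\Delta_{\alpha,\beta}:H_{\alpha\beta}\to H_\alpha\otimes H_\beta$ and $\varepsilon:H_e\to k$ such that $(\Delta_{\alpha,\beta}\otimes id)\Delta_{\alpha\beta,\gamma}=(id\otimes\Delta_{\beta,\gamma})\Delta_{\alpha,\beta\gamma}$ and $(id\otimes\varepsilon)\Delta_{\alpha,e}=id=(\varepsilon\otimes id)\Delta_{e,\alpha}$, together with linear maps (the antipode) $S_\alpha:H_\alpha\to H_{\alpha^{-1}}$ with $m_\alpha(S_{\alpha^{-1}}\otimes id)\Delta_{\alpha^{-1},\alpha}=\varepsilon 1_\alpha=m_\alpha(id\otimes S_{\alpha^{-1}})\Delta_{\alpha,\alpha^{-1}}$ on $H_e$. The antipode is bijective if every $S_\alpha$ is bijective. Right $H$-comodule: a family $M=\{M_\alpha\}_{\alpha\in G}$ of vector spaces with linear maps $\rho_{\alpha,\beta}:M_{\alpha\beta}\to M_\alpha\otimes H_\beta$, written $\rho_{\alpha,\beta}(m)=m_{(0,\alpha)}\otimes m_{(1,\beta)}$, such that $(id\otimes\Delta_{\beta,\gamma})\rho_{\alpha,\beta\gamma}=(\rho_{\alpha,\beta}\otimes id)\rho_{\alpha\beta,\gamma}$ and $(id\otimes\varepsilon)\rho_{\alpha,e}=id$. A morphism of families is a family of linear maps $f_\alpha:M_\alpha\to N_\alpha$; it is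 $H$-colinear if $\rho_{\alpha,\beta}f_{\alpha\beta}=(f_\alpha\otimes id)\rho_{\alpha,\beta}$. $H$ is a right $H$-comodule via $\Delta$. Right $H$-comodule Poisson algebra: a family $A=\{A_\alpha\}$ of (commutative) Poisson algebras which is a right $H$-comodule such that each $\rho_{\alpha,\beta}:A_{\alpha\beta}\to A_\alpha\otimes H_\beta$ is an algebra map and $\rho_{\alpha,\beta}(\{a,b\})=\{a_{(0,\alpha)},b_{(0,\alpha)}\}\otimes a_{(1,\beta)}b_{(1,\beta)}$ for $a,b\in A_{\alpha\beta}$. Poisson $(A,H)$-Hopf module: a right $H$-comodule $M$ such that each $M_\alpha$ is an $A_\alpha$-module (action $a\cdot m$) and a Lie module over the Lie algebra $(A_\alpha,\{\,,\})$ (action $a\diamond m$), with $a\diamond(b\cdot m)=\{a,b\}\cdot m+b\cdot(a\diamond m)$ and $(ab)\diamond m=a\cdot(b\diamond m)+b\cdot(a\diamond m)$ for $a,b\in A_\alpha,m\in M_\alpha$, and $\rho_{\alpha,\beta}(a\cdot m)=a_{(0,\alpha)}\cdot m_{(0,\alpha)}\otimes a_{(1,\beta)}m_{(1,\beta)}$, $\rho_{\alpha,\beta}(a\diamond m)=a_{(0,\alpha)}\diamond m_{(0,\alpha)}\otimes a_{(1,\beta)}m_{(1,\beta)}$ for $a\in A_{\alpha\beta},m\in M_{\alpha\beta}$. Morphisms are the $A$-linear, Lie $A$-linear, $H$-colinear families of maps. $A$ itself is a Poisson $(A,H)$-Hopf module with $a\diamond b=\{a,b\}$. Coinvariants: $M^{coH}_\alpha$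 is the image in $M_\alpha$ of the set of families $(m_\alpha)\in\prod_{\alpha}M_\alpha$ with $\rho_{\alpha,\beta}(m_{\alpha\beta})=m_\alpha\otimes 1_{H_\beta}$ for all $\alpha,\beta$; $M^{coH}=\{M^{coH}_\alpha\}$. Further $M_\alpha^{A_\alpha}=\{m\in M_\alpha: a\diamond m=0\ \forall a\in A_\alpha\}$, $M^{AcoH}_\alpha=M^{coH}_\alpha\cap M_\alpha^{A_\alpha}$, $M^{AcoH}=\{M^{AcoH}_\alpha\}$; the same notation applies to $M=A$. $A^A=\{A_\alpha^{A_\alpha}\}$ is the family of Poisson centers. $\phi$ is an algebra map if every $\phi_\alpha$ is an algebra map. The Poisson $(A,H)$-Hopf module structure on $A\otimes_BM^{AcoH}=\{A_\alpha\otimes_{B_\alpha}M_\alpha^{AcoH}\}$ is $a'\cdot(a\otimes m_\alpha)=a'a\otimes m_\alpha$, $a'\diamond(a\otimes m_\alpha)=\{a',a\}\otimes m_\alpha$, and $\rho_{\mu,\nu}(a\otimes m_\alpha)=(a_{(0,\mu)}\otimes_{B_\mu} m_\mu)\otimes a_{(1,\nu)}$ for $\mu\nu=\alpha$, where $m_\mu$ denotes the components of a coinvariant family $m=(m_\alpha)$, so that $\rho_{\mu,\nu}(m_\alpha)=m_\mu\otimes 1_{H_\nu}$. The action $\diamond'$: for a Poisson $(A,H)$-Hopf module $M$ let $p^M_\alpha:M_e\to M_\alpha$, $p^M_\alpha(m)=\phi_\alpha(S_\alpha^{-1}(m_{(1,\alpha^{-1})}))\cdot m_{(0,\alpha)}$,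 where $\rho_{\alpha,\alpha^{-1}}(m)=m_{(0,\alpha)}\otimes m_{(1,\alpha^{-1})}$. The image of $p^M_\alpha$ is $M^{coH}_\alpha$, and the Lie algebra $A_e$ acts on $M^{coH}_\alpha$ by $a\diamond' p^M_\alpha(m)=p^M_\alpha(a\diamond m)$ for $a\in A_e,m\in M_e$. It is trivial if $a\diamond' x=0$ for all $a\in A_e$, $x\in M_\alpha^{coH}$, $\alpha\in G$. *)

(* Defs.v *)
From HB Require Import structures.
From mathcomp Require Import all_boot all_algebra.
From mathcomp Require Import boolp classical_sets.

Set Implicit Arguments.
Unset Strict Implicit.
Unset Printing Implicit Defensive.

Import GRing.Theory.
Local Open Scope quotient_scope.
Local Open Scope ring_scope.

(* Mathcomp has no tensor product of arbitrary (infinite-dimensional) modules. *)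
(* A tensor is a finite formal sum of pairs, represented as a list, modulo the *)
(* usual relations.  The balancing relation is kept general: I is a set of     *)
(* scalars acting on U by rho_U and on V by rho_V, and the resulting module is *)
(* U (x)_Z V modulo u.i (x) v = u (x) i.v.  With I = k it is U (x)_k V, with   *)
(* I = B a k-algebra it is U (x)_B V.  k acts through U.                       *)
Section BalancedTensor.
Variables (k : comPzRingType) (U V : lmodType k) (I : Type).
Variables (actU : I -> {linear U -> U}) (actV : I -> V -> V).

Inductive tensor_eq : seq (U * V) -> seq (U * V) -> Prop :=
| tensor_eq_refl s : tensor_eq s s
| tensor_eq_sym s t : tensor_eq s t -> tensor_eq t s
| tensor_eq_trans s t w : tensor_eq s t -> tensor_eq t w -> tensor_eq s w
| tensor_eq_cat s s' t t' :
    tensor_eq s s' -> tensor_eq t t' -> tensor_eq (s ++ t) (s' ++ t')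
| tensor_eq_catC s t : tensor_eq (s ++ t) (t ++ s)
| tensor_eq_0l v : tensor_eq [:: (0, v)] [::]
| tensor_eq_Dl u u' v : tensor_eq [:: (u + u', v)] [:: (u, v); (u', v)]
| tensor_eq_Dr u v v' : tensor_eq [:: (u, v + v')] [:: (u, v); (u, v')]
| tensor_eq_bal i u v : tensor_eq [:: (actU i u, v)] [:: (u, actV i v)].

Definition tensor_eqb (s t : seq (U * V)) : bool := `[< tensor_eq s t >].

Lemma tensor_eqb_refl : reflexive tensor_eqb.
Proof. by move=> s; apply/asboolP; exact: tensor_eq_refl. Qed.

Lemma tensor_eqb_sym : symmetric tensor_eqb.
Proof. by move=> s t; apply/asboolP/asboolP; exact: tensor_eq_sym. Qed.

Lemma tensor_eqb_trans : transitive tensor_eqb.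
Proof.
by move=> t s w /asboolP st /asboolP tw; apply/asboolP; exact: tensor_eq_trans tw.
Qed.

Canonical tensor_equiv :=
  EquivRel tensor_eqb tensor_eqb_refl tensor_eqb_sym tensor_eqb_trans.

Definition btensor := {eq_quot tensor_equiv}%qT.
HB.instance Definition _ := Choice.on btensor.
HB.instance Definition _ := Quotient.on btensor.

Implicit Types (s t : seq (U * V)) (x y z : btensor).

Definition tclass s : btensor := \pi_btensor s.
Definition btens (u : U) (v : V) : btensor := tclass [:: (u, v)].

Lemma tclassP s t : tensor_eq s t <-> tclass s = tclass t.
Proof.
split=> [st|/eqmodP/asboolP//]; apply/eqmodP; exact/asboolP.
Qed.

Lemma tclassK x : tclass (repr x) = x. Proof. exact: reprK. Qed.

Definition tadd x y : btensor := tclass (repr x ++ repr y).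
Definition tmapl (f : U -> U) s := [seq (f p.1, p.2) | p <- s].
Definition topp x : btensor := tclass (tmapl -%R (repr x)).
Definition tscale (a : k) x : btensor := tclass (tmapl ( *:%R a) (repr x)).

Lemma tclass_cat s t : tadd (tclass s) (tclass t) = tclass (s ++ t).
Proof. by apply/tclassP/tensor_eq_cat; apply/tclassP; rewrite tclassK. Qed.

Lemma tmapl_eq (f : {linear U -> U}) s t :
  (forall i u, f (actU i u) = actU i (f u)) ->
  tensor_eq s t -> tensor_eq (tmapl f s) (tmapl f t).
Proof.
move=> fC; elim=> {s t}.
- by move=> s; exact: tensor_eq_refl.
- by move=> s t _; exact: tensor_eq_sym.
- by move=> s t w _ st _ tw; exact: tensor_eq_trans tw.
- by move=> s s' t t' _ ss _ tt; rewrite /tmapl !map_cat; exact: tensor_eq_cat.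
- by move=> s t; rewrite /tmapl !map_cat; exact: tensor_eq_catC.
- by move=> v; rewrite /= raddf0; exact: tensor_eq_0l.
- by move=> u u' v; rewrite /= raddfD; exact: tensor_eq_Dl.
- by move=> u v v'; exact: tensor_eq_Dr.
- by move=> i u v; rewrite /= fC; exact: tensor_eq_bal.
Qed.

Lemma tclass_scale a s : tscale a (tclass s) = tclass (tmapl ( *:%R a) s).
Proof.
apply/tclassP; apply: tmapl_eq; first by move=> i u /=; rewrite linearZ.
by apply/tclassP; rewrite tclassK.
Qed.

Lemma toppE x : topp x = tscale (-1) x.
Proof. by rewrite /topp /tscale /tmapl; congr tclass; apply: eq_map => p; rewrite scaleN1r. Qed.

Lemma taddA : associative tadd.
Proof.
by move=> x y z; rewrite -[x]tclassK -[y]tclassK -[z]tclassK !tclass_cat catA.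
Qed.

Lemma taddC : commutative tadd.
Proof. by move=> x y; apply/tclassP; exact: tensor_eq_catC. Qed.

Lemma tadd0 : left_id (tclass [::]) tadd.
Proof. by move=> x; rewrite -[x]tclassK tclass_cat. Qed.

Lemma taddN : left_inverse (tclass [::]) topp tadd.
Proof.
have tACA a b c d : tadd (tadd a b) (tadd c d) = tadd (tadd a c) (tadd b d).
  by rewrite -!taddA; congr (tadd a _); rewrite !taddA [tadd b c]taddC.
move=> x; rewrite -[x]tclassK toppE tclass_scale.
elim: (repr x) => [|[u v] s IHs]; first by rewrite tclass_cat.
rewrite /= -[_ :: tmapl _ s]cat1s -[(u, v) :: s]cat1s -!tclass_cat tACA IHs.
rewrite [tadd (tclass [:: (_, _)]) _]tclass_cat.
have -> : tclass ([:: (-1 *: u, v)] ++ [:: (u, v)]) = tclass [::].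
  apply/tclassP; apply: tensor_eq_trans (tensor_eq_0l v).
  rewrite -[X in tensor_eq _ [:: (X, v)]](addNr u) scaleN1r.
  exact/tensor_eq_sym/tensor_eq_Dl.
exact: tadd0.
Qed.

HB.instance Definition _ := GRing.isZmodule.Build btensor taddA taddC tadd0 taddN.

Lemma tclassD s t : tclass (s ++ t) = tclass s + tclass t.
Proof. by rewrite -tclass_cat. Qed.

Lemma tclassE s : tclass s = \sum_(p <- s) btens p.1 p.2.
Proof.
elim: s => [|[u v] s IHs]; first by rewrite big_nil.
by rewrite big_cons -IHs -tclassD.
Qed.

Lemma tscaleA a b x : tscale a (tscale b x) = tscale (a * b) x.
Proof.
rewrite -[x]tclassK !tclass_scale /tmapl -map_comp.
by congr tclass; apply: eq_map => p; rewrite /= scalerA.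
Qed.

Lemma tscale1 : left_id 1 tscale.
Proof.
move=> x; rewrite -[x]tclassK tclass_scale; congr tclass.
by rewrite /tmapl -[RHS]map_id; apply: eq_map => -[u v]; rewrite /= scale1r.
Qed.

Lemma tscaleDr : right_distributive tscale +%R.
Proof.
move=> a x y; rewrite -[x]tclassK -[y]tclassK -tclassD !tclass_scale.
by rewrite /tmapl map_cat tclassD.
Qed.

Lemma tscaleDl x : {morph tscale^~ x : a b / a + b}.
Proof.
move=> a b; rewrite -[x]tclassK !tclass_scale !tclassE !big_map -big_split /=.
apply: eq_bigr => p _; rewrite -[RHS]tclassD scalerDl.
by apply/tclassP; exact: tensor_eq_Dl.
Qed.

HB.instance Definition _ :=
  GRing.Zmodule_isLmodule.Build k btensor tscaleA tscale1 tscaleDr tscaleDl.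

Lemma btensDl v : {morph btens^~ v : u u' / u + u'}.
Proof. by move=> u u'; rewrite -tclassD; apply/tclassP; exact: tensor_eq_Dl. Qed.

Lemma btensDr u : {morph btens u : v v' / v + v'}.
Proof. by move=> v v'; rewrite -tclassD; apply/tclassP; exact: tensor_eq_Dr. Qed.

Lemma btensZl a u v : btens (a *: u) v = a *: btens u v.
Proof. by rewrite -[RHS]/(tscale _ _) tclass_scale. Qed.

Lemma btens_bal i u v : btens (actU i u) v = btens u (actV i v).
Proof. by apply/tclassP; exact: tensor_eq_bal. Qed.

Lemma btens_ind (P : btensor -> Prop) :
  P 0 -> (forall x y, P x -> P y -> P (x + y)) ->
  (forall u v, P (btens u v)) -> forall x, P x.
Proof.
move=> P0 PD Pt x; rewrite -[x]tclassK tclassE; elim: (repr x) => [|p s IHs].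
  by rewrite big_nil.
by rewrite big_cons; apply: PD.
Qed.

(* Sweedler-style evaluation: if x = sum u_i (x) v_i then tlift f x is        *)
(* sum f u_i v_i.  Defined for every f through a chosen representative; it is *)
(* independent of it as soon as f is biadditive and balanced (tliftE).        *)
Definition tlift (W : zmodType) (f : U -> V -> W) x : W :=
  \sum_(p <- repr x) f p.1 p.2.

Section Lift.
Variables (W : zmodType) (f : U -> V -> W).
Hypothesis fDl : forall v, {morph f^~ v : u u' / u + u'}.
Hypothesis fDr : forall u, {morph f u : v v' / v + v'}.
Hypothesis f_bal : forall i u v, f (actU i u) v = f u (actV i v).

Lemma tlift_class s : tlift f (tclass s) = \sum_(p <- s) f p.1 p.2.
Proof.
have E s1 s2 : tensor_eq s1 s2 ->
    \sum_(p <- s1) f p.1 p.2 = \sum_(p <- s2) f p.1 p.2; last first.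
  by apply: E; apply/tclassP; rewrite tclassK.
elim=> {s s1 s2} //.
- by move=> s t w _ -> _ ->.
- by move=> s s' t t' _ ss _ tt; rewrite !big_cat /= ss tt.
- by move=> s t; rewrite !big_cat /= addrC.
- move=> v; rewrite big_seq1 big_nil /=.
  by apply: (addrI (f 0 v)); rewrite -fDl !addr0.
- by move=> u u' v; rewrite !big_cons !big_nil !addr0 /= fDl.
- by move=> u v v'; rewrite !big_cons !big_nil !addr0 /= fDr.
- by move=> i u v; rewrite !big_seq1 /= f_bal.
Qed.

Lemma tliftE u v : tlift f (btens u v) = f u v.
Proof. by rewrite tlift_class big_seq1. Qed.

Lemma tliftD : {morph tlift f : x y / x + y}.
Proof.
move=> x y; rewrite -[x]tclassK -[y]tclassK -tclassD.
by rewrite !tlift_class big_cat.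
Qed.

End Lift.

Lemma tlift_linear (W : lmodType k) (f : U -> V -> W) :
  (forall v, linear (f^~ v)) -> (forall u, {morph f u : v v' / v + v'}) ->
  (forall i u v, f (actU i u) v = f u (actV i v)) -> linear (tlift f).
Proof.
move=> fl fDr f_bal; have fDl v : {morph f^~ v : u u' / u + u'}.
  by move=> u u' /=; have := fl v 1 u u'; rewrite !scale1r.
move=> a x y; rewrite tliftD //; congr (_ + _).
rewrite -[x]tclassK -[a *: _]/(tscale _ _) tclass_scale !tlift_class //.
rewrite big_map scaler_sumr; apply: eq_bigr => p _ /=.
have f0 : f 0 p.2 = 0 by apply: (addrI (f 0 p.2)); rewrite -fDl !addr0.
by have := fl p.2 a p.1 0; rewrite f0 !addr0.
Qed.

End BalancedTensor.

Notation bilin f := (bilinear_for *:%R *:%R f).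

Section Tensor.
Variable k : fieldType.
Implicit Types U V W : lmodType k.

Definition tensor U V :=
  @btensor k U V k (fun a => *:%R a : {linear U -> U}) *:%R.
HB.instance Definition _ U V := GRing.Lmodule.on (tensor U V).

Definition tens U V (u : U) (v : V) : tensor U V := btens _ _ u v.

(* tfold f x is sum f u_i v_i when x = sum u_i (x) v_i. *)
Definition tfold U V (W : zmodType) (f : U -> V -> W) (x : tensor U V) : W :=
  tlift f x.

Section Theory.
Variables (U V : lmodType k).

Lemma tens_bilin : bilin (@tens U V).
Proof.
split=> [v a u u'|u a v v'] /=; rewrite /tens ?(btensDl, btensDr) ?btensZl //.
by congr (_ + _); rewrite -btensZl -btens_bal.
Qed.

Lemma tensor_ind (P : tensor U V -> Prop) :
  P 0 -> (forall x y, P x -> P y -> P (x + y)) ->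
  (forall u v, P (tens u v)) -> forall x, P x.
Proof. exact: btens_ind. Qed.

Section Fold.
Variables (W : lmodType k) (f : U -> V -> W).
Hypothesis fB : bilin f.

Let fDl v : {morph f^~ v : u u' / u + u'}.
Proof. by move=> u u' /=; have /= := fB.1 v 1 u u'; rewrite !scale1r. Qed.
Let fDr u : {morph f u : v v' / v + v'}.
Proof. by move=> v v' /=; have /= := fB.2 u 1 v v'; rewrite !scale1r. Qed.
Let f0l v : f 0 v = 0.
Proof. by apply: (addrI (f 0 v)); rewrite -fDl !addr0. Qed.
Let f0r u : f u 0 = 0.
Proof. by apply: (addrI (f u 0)); rewrite -fDr !addr0. Qed.
Let f_bal a u v : f (a *: u) v = f u (a *: v).
Proof.
by have /= := fB.1 v a u 0; have /= := fB.2 u a v 0; rewrite f0l f0r !addr0 => -> ->.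
Qed.

Lemma tfoldE u v : tfold f (tens u v) = f u v.
Proof. exact: tliftE. Qed.

Lemma tfold_linear : linear (tfold f).
Proof. by apply: tlift_linear => //; exact: fB.1. Qed.
End Fold.
End Theory.

Definition tmap U U' V V' (f : U -> U') (g : V -> V') (x : tensor U V) :
    tensor U' V' :=
  tfold (fun u v => tens (f u) (g v)) x.

Definition tmap2 U U' U'' V V' V'' (f : U -> U' -> U'') (g : V -> V' -> V'')
    (x : tensor U V) (y : tensor U' V') : tensor U'' V'' :=
  tfold (fun u v => tfold (fun u' v' => tens (f u u') (g v v')) y) x.

Definition tassoc U V W (x : tensor (tensor U V) W) : tensor U (tensor V W) :=
  tfold (fun y w => tfold (fun u v => tens u (tens v w)) y) x.

End Tensor.

(* Unital associative k-algebras.  Mathcomp's algType k requires 1 != 0,      *)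
(* whereas components H_alpha or A_alpha equal to 0 are allowed here.         *)
HB.mixin Record Lmodule_isPzAlgebra (k : fieldType) A of GRing.Lmodule k A := {
  pzmul : A -> A -> A;
  pzone : A;
  pzmulA : associative pzmul;
  pzmul1l : left_id pzone pzmul;
  pzmul1r : right_id pzone pzmul;
  pzmul_bilin : bilin pzmul
}.

#[short(type="pzAlgType")]
HB.structure Definition PzAlgebra (k : fieldType) :=
  {A of GRing.Lmodule k A & Lmodule_isPzAlgebra k A}.

(* Commutative Poisson algebras. *)
HB.mixin Record PzAlgebra_isPoisson (k : fieldType) A of PzAlgebra k A := {
  pzmulC : commutative (@pzmul k A);
  poisson : A -> A -> A;
  poisson_bilin : bilin poisson;
  poissonxx : forall a, poisson a a = 0;
  poisson_jacobi : forall a b c,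
    poisson a (poisson b c) + poisson b (poisson c a) + poisson c (poisson a b)
      = 0;
  poissonM : forall a b c,
    poisson a (pzmul b c) = pzmul (poisson a b) c + pzmul b (poisson a c)
}.

#[short(type="poissonAlgType")]
HB.structure Definition PoissonAlgebra (k : fieldType) :=
  {A of PzAlgebra k A & PzAlgebra_isPoisson k A}.

Section PzRing.
Variables (k : fieldType) (A : pzAlgType k).

Lemma pzmulDl : left_distributive (@pzmul k A) +%R.
Proof. by move=> x y z; have /= := pzmul_bilin.1 z 1 x y; rewrite !scale1r. Qed.
Lemma pzmulDr : right_distributive (@pzmul k A) +%R.
Proof. by move=> x y z; have /= := pzmul_bilin.2 x 1 y z; rewrite !scale1r. Qed.

HB.instance Definition _ := GRing.Zmodule_isPzRing.Build (PzAlgebra.sort A)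
  pzmulA pzmul1l pzmul1r pzmulDl pzmulDr.
End PzRing.
HB.instance Definition _ (k : fieldType) (A : poissonAlgType k) :=
  GRing.PzRing.copy (PoissonAlgebra.sort A) (PzAlgebra.sort A).
HB.instance Definition _ (k : fieldType) (A : poissonAlgType k) :=
  GRing.PzRing_hasCommutativeMul.Build (PoissonAlgebra.sort A) pzmulC.

Section TensorAlgebra.
Variable k : fieldType.

Lemma lin0 (W W' : lmodType k) (h : W -> W') : linear h -> h 0 = 0.
Proof.
by move=> hl; apply: (addrI (h 0)); rewrite addr0 -{1}[h 0]scale1r -hl scale1r addr0.
Qed.
Lemma linD (W W' : lmodType k) (h : W -> W') : linear h -> {morph h : x y / x + y}.
Proof. by move=> hl x y; rewrite -[x in LHS]scale1r hl scale1r. Qed.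

Section Tmap2.
Variables (U U' U'' V V' V'' : lmodType k).
Variables (f : U -> U' -> U'') (g : V -> V' -> V'').
Hypotheses (fB : bilin f) (gB : bilin g).

Let F u v := fun u' v' => tens (f u u') (g v v').

Let F_bilin u v : bilin (F u v).
Proof.
rewrite /F; split=> [v' a x x'|u' a y y'] /=.
  by rewrite (fB.2 u) (tens_bilin _ _).1.
by rewrite (gB.2 v) (tens_bilin _ _).2.
Qed.

Let F_lin u v : linear (tfold (F u v)). Proof. exact: tfold_linear. Qed.

Let FF_bilin y : bilin (fun u v => tfold (F u v) y).
Proof.
split=> [v a u u'|u a v v'] /=; elim/tensor_ind: y => [|x y IHx IHy|x y].
- by rewrite !(lin0 (@F_lin _ _)) scaler0 addr0.
- by rewrite !(linD (@F_lin _ _)) IHx IHy scalerDr addrACA.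
- by rewrite !tfoldE // /F (fB.1 x) (tens_bilin _ _).1.
- by rewrite !(lin0 (@F_lin _ _)) scaler0 addr0.
- by rewrite !(linD (@F_lin _ _)) IHx IHy scalerDr addrACA.
- by rewrite !tfoldE // /F (gB.1 y) (tens_bilin _ _).2.
Qed.

Lemma tmap2E u v u' v' :
  tmap2 f g (tens u v) (tens u' v') = tens (f u u') (g v v').
Proof. by rewrite /tmap2 (tfoldE (FF_bilin _)) (tfoldE (F_bilin _ _)). Qed.

Lemma tmap2_bilin : bilin (tmap2 f g).
Proof.
split=> [y|x]; first exact: tfold_linear.
have xlin y : linear (fun x => tmap2 f g x y) by exact: tfold_linear.
move=> a y y' /=; elim/tensor_ind: x => [|x x' IHx IHx'|u v].
- by rewrite !(lin0 (xlin _)) scaler0 addr0.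
- by rewrite !(linD (xlin _)) IHx IHx' scalerDr addrACA.
- by rewrite /tmap2 !(tfoldE (FF_bilin _)) (@F_lin u v).
Qed.

End Tmap2.

Lemma tmapE (U U' V V' : lmodType k) (f : {linear U -> U'}) (g : {linear V -> V'})
  u v : tmap f g (tens u v) = tens (f u) (g v).
Proof.
apply: tfoldE; split=> [w a x x'|w a x x'] /=; rewrite linearP.
  exact: (tens_bilin _ _).1.
exact: (tens_bilin _ _).2.
Qed.

Lemma tassocE (U V W : lmodType k) (u : U) (v : V) (w : W) :
  tassoc (tens (tens u v) w) = tens u (tens v w).
Proof.
have tB (z : W) : bilin (fun (u : U) (v : V) => tens u (tens v z)).
  split=> [y a x x'|x a y y'] /=; first exact: (tens_bilin _ _).1.
  by rewrite (tens_bilin _ _).1 (tens_bilin _ _).2.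
rewrite /tassoc tfoldE ?(tfoldE (tB _)) //; split=> [z|x]; first exact: tfold_linear.
move=> a z z' /=; elim/tensor_ind: x => [|x y IHx IHy|x y].
- by rewrite !(lin0 (tfold_linear (tB _))) scaler0 addr0.
- by rewrite !(linD (tfold_linear (tB _))) IHx IHy scalerDr addrACA.
- by rewrite !tfoldE // -(tens_bilin _ _).2 (tens_bilin _ _).2.
Qed.

Variables (A B : pzAlgType k).

Let tmul : tensor A B -> tensor A B -> tensor A B :=
  tmap2 (@pzmul k A) (@pzmul k B).

Let tmul_bilin : bilin tmul.
Proof. by apply: tmap2_bilin; exact: pzmul_bilin. Qed.
Let tmulE a b a' b' :
  tmul (tens a b) (tens a' b') = tens (a * a') (b * b').
Proof. by rewrite /tmul tmap2E //; exact: pzmul_bilin. Qed.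
Let tmulDl x y z : tmul (x + y) z = tmul x z + tmul y z.
Proof. by have /= := tmul_bilin.1 z 1 x y; rewrite !scale1r. Qed.
Let tmulDr x y z : tmul x (y + z) = tmul x y + tmul x z.
Proof. by have /= := tmul_bilin.2 x 1 y z; rewrite !scale1r. Qed.
Let tmul0l x : tmul 0 x = 0.
Proof. by apply: (addrI (tmul 0 x)); rewrite -tmulDl !addr0. Qed.
Let tmul0r x : tmul x 0 = 0.
Proof. by apply: (addrI (tmul x 0)); rewrite -tmulDr !addr0. Qed.

Let tmulA : associative tmul.
Proof.
move=> x y z; elim/tensor_ind: x => [|x x' Hx Hx'|a b].
- by rewrite !tmul0l.
- by rewrite !tmulDl Hx Hx'.
elim/tensor_ind: y => [|y y' Hy Hy'|a' b'].
- by rewrite !(tmul0l, tmul0r).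
- by rewrite !(tmulDl, tmulDr) Hy Hy'.
elim/tensor_ind: z => [|z z' Hz Hz'|a'' b''].
- by rewrite !tmul0r.
- by rewrite !tmulDr Hz Hz'.
by rewrite !tmulE !mulrA.
Qed.

Let tmul1l : left_id (tens (1 : A) (1 : B)) tmul.
Proof.
elim/tensor_ind=> [|x y Hx Hy|a b]; first exact: tmul0r.
  by rewrite tmulDr Hx Hy.
by rewrite tmulE !mul1r.
Qed.

Let tmul1r : right_id (tens (1 : A) (1 : B)) tmul.
Proof.
elim/tensor_ind=> [|x y Hx Hy|a b]; first exact: tmul0l.
  by rewrite tmulDl Hx Hy.
by rewrite tmulE !mulr1.
Qed.

HB.instance Definition _ :=
  Lmodule_isPzAlgebra.Build k (tensor A B) tmulA tmul1l tmul1r tmul_bilin.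
HB.instance Definition _ :=
  GRing.PzRing.copy (tensor A B) (PzAlgebra.sort (tensor A B)).

Lemma tens_mul (a a' : A) (b b' : B) :
  tens a b * tens a' b' = tens (a * a') (b * b').
Proof. exact: tmulE. Qed.

End TensorAlgebra.

(* The abelian group G is written additively: alpha beta, e and alpha^-1 are  *)
(* a + b, 0 and - a.  H (a + b + c) and H (a + (b + c)) are equal but not     *)
(* convertible types; tr identifies the components along an equality of       *)
(* indices.                                                                   *)
Definition tr (G : Type) (F : G -> Type) (a b : G) (e : a = b) (x : F a) : F b :=
  ecast c (F c) e x.
Arguments tr {G} F {a b} e x.

Record hopfGCoalg (k : fieldType) (G : zmodType) (H : G -> pzAlgType k) := {
  comul : forall a b, {linear H (a + b) -> tensor (H a) (H b)};
  counit : {scalar H 0};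
  antipode : forall a, {linear H a -> H (- a)};
  comul_morph : forall a b, monoid_morphism (comul a b);
  counit_morph : monoid_morphism counit;
  comulA : forall a b c (h : H (a + b + c)),
    tassoc (tmap (comul a b) id (comul (a + b) c h))
      = tmap id (comul b c) (comul a (b + c) (tr H (esym (addrA a b c)) h));
  counitr : forall a (h : H a),
    tfold (fun x y => counit y *: x) (comul a 0 (tr H (esym (addr0 a)) h)) = h;
  counitl : forall a (h : H a),
    tfold (fun x y => counit x *: y) (comul 0 a (tr H (esym (add0r a)) h)) = h;
  antipodel : forall a (h : H 0),
    tfold (fun x y => tr H (opprK a) (antipode (- a) x) * y)
          (comul (- a) a (tr H (esym (addNr a)) h)) = counit h *: (1 : H a);
  antipoder : forall a (h : H 0),
    tfold (fun (x : H a) y => x * tr H (opprK a) (antipode (- a) y))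
          (comul a (- a) (tr H (esym (subrr a)) h)) = counit h *: (1 : H a)
}.

Section HopfModules.
Variables (k : fieldType) (G : zmodType) (H : G -> pzAlgType k).
Variable hH : hopfGCoalg H.

Definition antipode_bijective := forall a, bijective (antipode hH a).

(* S_a^-1 : H_{-a} -> H_a (when S_a is bijective). *)
Definition antipodeV (a : G) (h : H (- a)) : H a :=
  xget 0 [set x | antipode hH a x = h].

Record comodule (M : G -> lmodType k) := {
  coact : forall a b, {linear M (a + b) -> tensor (M a) (H b)};
  coactA : forall a b c (m : M (a + b + c)),
    tassoc (tmap (coact a b) id (coact (a + b) c m))
      = tmap id (comul hH b c) (coact a (b + c) (tr M (esym (addrA a b c)) m));
  coact_counit : forall a (m : M a),
    tfold (fun x h => counit hH h *: x)
          (coact a 0 (tr M (esym (addr0 a)) m)) = m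
}.

Definition regular_comodule : comodule H :=
  {| coactA := comulA hH; coact_counit := counitr hH |}.

Definition colinear (M N : G -> lmodType k) (cM : comodule M) (cN : comodule N)
    (f : forall a, M a -> N a) : Prop :=
  forall a b (m : M (a + b)),
    coact cN a b (f (a + b) m) = tmap (f a) id (coact cM a b m).

(* coinv cM a is M^{coH}_a: the a-components of the families (m_b) such that  *)
(* coact (m_{b + c}) = m_b (x) 1.                                             *)
Definition coinv_family (M : G -> lmodType k) (cM : comodule M)
    (m : forall a, M a) : Prop :=
  forall a b, coact cM a b (m (a + b)) = tens (m a) (1 : H b).

Definition coinv (M : G -> lmodType k) (cM : comodule M) (a : G) (x : M a) : Prop :=
  exists2 m : forall b, M b, coinv_family cM m & m a = x.

Record comodulePoissonAlg (A : G -> poissonAlgType k) := {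
  cpa_comodule :> comodule A;
  cpa_coact_morph : forall a b, monoid_morphism (coact cpa_comodule a b);
  cpa_coact_poisson : forall a b (x y : A (a + b)),
    coact cpa_comodule a b (poisson x y)
      = tmap2 poisson (@pzmul k (H b)) (coact cpa_comodule a b x) (coact cpa_comodule a b y)
}.

Section OverA.
Variables (A : G -> poissonAlgType k) (hA : comodulePoissonAlg A).

(* act x m is the A_a-module action x . m and lie x m the Lie action x <> m.   *)
Record poissonHopfModule (M : G -> lmodType k) := {
  phm_comodule :> comodule M;
  act : forall a, A a -> M a -> M a;
  lie : forall a, A a -> M a -> M a;
  act_bilin : forall a, bilin (@act a);
  act1 : forall a (m : M a), act 1 m = m;
  actM : forall a (x y : A a) (m : M a), act (x * y) m = act x (act y m);
  lie_bilin : forall a, bilin (@lie a);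
  lie_poisson : forall a (x y : A a) (m : M a),
    lie (poisson x y) m = lie x (lie y m) - lie y (lie x m);
  lie_act : forall a (x y : A a) (m : M a),
    lie x (act y m) = act (poisson x y) m + act y (lie x m);
  lie_mul : forall a (x y : A a) (m : M a),
    lie (x * y) m = act x (lie y m) + act y (lie x m);
  coact_act : forall a b (x : A (a + b)) (m : M (a + b)),
    coact phm_comodule a b (act x m)
      = tmap2 (@act a) (@pzmul k (H b)) (coact hA a b x) (coact phm_comodule a b m);
  coact_lie : forall a b (x : A (a + b)) (m : M (a + b)),
    coact phm_comodule a b (lie x m)
      = tmap2 (@lie a) (@pzmul k (H b)) (coact hA a b x) (coact phm_comodule a b m)
}.

Record phm_morphism (M N : G -> lmodType k) (hM : poissonHopfModule M)
    (hN : poissonHopfModule N) (f : forall a, M a -> N a) : Prop := {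
  phm_mor_linear : forall a, linear (f a);
  phm_mor_act : forall a (x : A a) (m : M a),
    f a (act hM x m) = act hN x (f a m);
  phm_mor_lie : forall a (x : A a) (m : M a),
    f a (lie hM x m) = lie hN x (f a m);
  phm_mor_colinear : colinear hM hN f
}.

Definition phm_isomorphism (M N : G -> lmodType k) (hM : poissonHopfModule M)
    (hN : poissonHopfModule N) (f : forall a, M a -> N a) : Prop :=
  phm_morphism hM hN f /\
  exists g : forall a, N a -> M a,
    [/\ phm_morphism hN hM g, forall a, cancel (f a) (g a)
      & forall a, cancel (g a) (f a)].

Section Regular.
Variable a : G.
Implicit Types x y m : A a.

Lemma poissonC x y : poisson x y = - poisson y x.
Proof.
have pB := @poisson_bilin k (A a).
apply/eqP; rewrite -addr_eq0; apply/eqP; have := poissonxx (x + y).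
have /= -> := linD (pB.1 (x + y)) x y.
by have /= -> := linD (pB.2 x) x y; have /= -> := linD (pB.2 y) x y;
  rewrite !poissonxx add0r addr0.
Qed.

Lemma regular_lie_poisson x y m :
  poisson (poisson x y) m = poisson x (poisson y m) - poisson y (poisson x m).
Proof.
have pB := @poisson_bilin k (A a); have := poisson_jacobi x y m.
have pN (u v : A a) : poisson u (- v) = - poisson u v.
  by apply: (addrI (poisson u v)); rewrite -(linD (pB.2 u)) !subrr (lin0 (pB.2 u)).
rewrite [poisson m x]poissonC [poisson m (poisson x y)]poissonC pN.
by move/eqP; rewrite subr_eq0 => /eqP <-.
Qed.

Lemma regular_lie_mul x y m :
  poisson (x * y) m = x * poisson y m + y * poisson x m.
Proof.
rewrite poissonC poissonM [poisson m x]poissonC [poisson m y]poissonC.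
rewrite -![pzmul _ _]/(_ * _) mulNr mulrN opprD !opprK addrC.
by rewrite [poisson x m * y]mulrC.
Qed.

End Regular.

(* A as a Poisson (A, H)-Hopf module: x . y = x y and x <> y = {x, y}. *)
Definition regular_phm : poissonHopfModule A := {|
  phm_comodule := hA;
  act := fun a => @pzmul k (A a);
  lie := fun a => @poisson k (A a);
  act_bilin := fun a => @pzmul_bilin k (A a);
  act1 := fun a => @pzmul1l k (A a);
  actM := fun a x y m => esym (pzmulA x y m);
  lie_bilin := fun a => @poisson_bilin k (A a);
  lie_poisson := regular_lie_poisson;
  lie_act := fun a => @poissonM k (A a);
  lie_mul := regular_lie_mul;
  coact_act := fun a b => (cpa_coact_morph hA a b).2;
  coact_lie := cpa_coact_poisson hA
|}.

Definition invariant (M : G -> lmodType k) (hM : poissonHopfModule M)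
    (a : G) (m : M a) : Prop :=
  forall x : A a, lie hM x m = 0.

(* M^{AcoH}_a *)
Section ACoinvariants.
Variables (M : G -> lmodType k) (hM : poissonHopfModule M) (a : G).

Definition acoinv : {pred M a} := fun m => `[< coinv hM m /\ invariant hM m >].

Lemma acoinv_closed : submod_closed acoinv.
Proof.
split=> [|c x y /asboolP[[f fF <-] fI] /asboolP[[g gF <-] gI]].
  apply/asboolP; split; last by move=> x; exact: (lin0 ((lie_bilin hM a).2 x)).
  exists (fun=> 0) => // b c; rewrite linear0.
  by rewrite (lin0 ((tens_bilin _ _).1 _)).
apply/asboolP; split.
  exists (fun b => c *: f b + g b) => // b d.
  by rewrite linearP fF gF (tens_bilin _ _).1.
by move=> z; rewrite ((lie_bilin hM a).2 z) fI gI /= scaler0 addr0.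
Qed.

HB.instance Definition _ :=
  GRing.isSubmodClosed.Build k (M a) acoinv acoinv_closed.

Record acoinvType := Acoinv { acoinv_val : M a; _ : acoinv_val \in acoinv }.
HB.instance Definition _ := [isSub for acoinv_val].
HB.instance Definition _ := [Choice of acoinvType by <:].
HB.instance Definition _ := [SubChoice_isSubLmodule of acoinvType by <:].
End ACoinvariants.

(* B = A^{AcoH} *)
Definition baseAlg (a : G) := acoinvType regular_phm a.

Section BaseAction.
Variables (M : G -> lmodType k) (hM : poissonHopfModule M) (a : G).

Lemma act_acoinv (b : baseAlg a) (m : acoinvType hM a) :
  act hM (acoinv_val b) (acoinv_val m) \in @acoinv M hM a.
Proof.
case: b m => b /= /asboolP[[f fF <-] fI] [m /= /asboolP[[g gF <-] gI]].
apply/asboolP; split.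
  exists (fun c => act hM (f c) (g c)) => // c d.
  rewrite coact_act fF gF tmap2E; first by rewrite pzmul1l.
    exact: act_bilin.
  exact: pzmul_bilin.
move=> x; rewrite lie_act gI; have /= -> := fI x.
by rewrite (lin0 ((act_bilin hM a).1 _)) (lin0 ((act_bilin hM a).2 _)) addr0.
Qed.

Definition base_act (b : baseAlg a) (m : acoinvType hM a) : acoinvType hM a :=
  Acoinv (act_acoinv b m).

Definition base_mulr (b : baseAlg a) (x : A a) : A a := x * (acoinv_val b).

Lemma base_mulr_linear b : linear (base_mulr b).
Proof. by move=> c x y; exact: pzmul_bilin.1. Qed.
HB.instance Definition _ b :=
  GRing.isLinear.Build k (A a) (A a) *:%R (base_mulr b) (base_mulr_linear b).

(* A_a (x)_{B_a} M^{AcoH}_a *)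
Definition induced :=
  btensor (fun b => base_mulr b : {linear A a -> A a}) base_act.
HB.instance Definition _ := GRing.Lmodule.on induced.

Definition itens (x : A a) (m : acoinvType hM a) : induced := btens _ _ x m.

Definition induced_map : induced -> M a :=
  tlift (fun x (m : acoinvType hM a) => act hM x (acoinv_val m)).

Lemma induced_mapE x m : induced_map (itens x m) = act hM x (acoinv_val m).
Proof.
apply: tliftE => [n y z|y n p|b y n] /=.
- exact: (linD ((act_bilin hM a).1 _)).
- exact: (linD ((act_bilin hM a).2 _)).
- exact: actM.
Qed.
End BaseAction.

(* hI is the Poisson (A, H)-Hopf module structure on A (x)_B M^{AcoH}.  In    *)
(* the last clause m is a coinvariant family whose components m_{a + b} and   *)
(* m_a, as elements of M^{AcoH}, are mab and ma; the right-hand side is       *)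
(* (x_(0,a) (x)_{B_a} m_a) (x) x_(1,b).                                       *)
Definition induced_structure (M : G -> lmodType k) (hM : poissonHopfModule M)
    (hI : poissonHopfModule (induced hM)) : Prop :=
  [/\ forall a (x y : A a) (m : acoinvType hM a),
        act hI x (itens y m) = itens (x * y) m,
      forall a (x y : A a) (m : acoinvType hM a),
        lie hI x (itens y m) = itens (poisson x y) m
    & forall (m : forall a, M a), coinv_family hM m ->
        forall a b (x : A (a + b))
          (mab : acoinvType hM (a + b)) (ma : acoinvType hM a),
        acoinv_val mab = m (a + b) -> acoinv_val ma = m a ->
        coact hI a b (itens x mab)
          = tmap (fun y => itens y ma) id (coact hA a b x)].

Section LieAction.
Variable phi : forall a, {linear H a -> A a}.

(* A right H-colinear algebra map H -> A^A, viewed as a map to A with values  *)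
(* in the Poisson centres (A^A itself need not be an H-subcomodule of A).     *)
Definition poisson_central_map : Prop :=
  [/\ forall a, monoid_morphism (phi a),
      colinear regular_comodule hA phi
    & forall a h, invariant regular_phm (phi a h)].

Variables (M : G -> lmodType k) (hM : poissonHopfModule M).

(* p^M_a(m) = phi_a(S_a^-1(m_(1,-a))) . m_(0,a) *)
Definition coinv_proj (a : G) (m : M 0) : M a :=
  tfold (fun m0 m1 => act hM (phi a (antipodeV m1)) m0)
        (coact hM a (- a) (tr M (esym (subrr a)) m)).

(* lie' x m y is the graph of the action of A_e on M^{coH}_a: y = x <>' m,    *)
(* where x <>' p^M_a(n) = p^M_a(x <> n).                                      *)
Definition lie' (a : G) (x : A 0) (m y : M a) : Prop :=
  exists2 n : M 0, m = coinv_proj a n & y = coinv_proj a (lie hM x n).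

Definition trivial_lie' : Prop :=
  forall a (x : A 0) (m y : M a), coinv hM m -> lie' x m y -> y = 0.
End LieAction.

End OverA.
End HopfModules.

(* Main.v *)
(* Write m_0 (x) m_1 for the coaction, p_a : M_e -> M_a for coinv_proj and S' *)
(* for the inverse of the antipode.  Both the coaction composed with p_(ab)   *)
(* and p_a (x) 1 turn into the coaction when convolved with                   *)
(* g := coact o phi_(ab); as g is convolution invertible, they agree, so p_a  *)
(* takes coinvariant values.  Since phi is central and A commutative,         *)
(* x <> p_a(n) = phi_a(x_1) p_a(x_0 <> n) for x in A_a, which vanishes when   *)
(* <>' is trivial; hence M^{coH} = M^{AcoH}, and likewise for A.  Now         *)
(* m = phi_a(m_1) p_a(m_0), and p_a(x_0 . m_e) = p_a(x_0) . m_a for a         *)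
(* coinvariant family m, where p_a(x_0) lies in B_a.  These two identities    *)
(* say that m |-> phi_a(m_1) (x) p_a(m_0) is inverse to Phi_a.                *)

From HB Require Import structures.
Require Import Defs.
From mathcomp Require Import all_boot all_algebra.
From mathcomp Require Import boolp classical_sets.

Set Implicit Arguments.
Unset Strict Implicit.
Unset Printing Implicit Defensive.

Import GRing.Theory.
Local Open Scope ring_scope.

(** The map [phi] makes the coaction reversible. Twisting m_0 by phi(S'(m_1)) gives [coinv_proj],
    and multiplying back by phi recovers m ([coinv_proj_reconstruct]), so M_a is generated over A_a
    by the values of [coinv_proj]. These values are coinvariant ([coinv_proj_coact], via
    [convolution_inj]), and each coinvariant is such a value ([coinv_proj_coinv]).

    Triviality of the action concerns only the Lie algebra A_e. [coinv_proj_invariant] extends it to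
    a vanishing Lie action of every A_a, so coinvariants already lie in M^{AcoH} ([coinv_acoinv])
    and [induced_inv] can take values in the tensor product over B.

    One composite with Phi is the identity by reconstruction in M ([induced_invK]). For the other
    ([induced_mapK]), [induced_inv_act] uses reconstruction in A, with the projected coefficients
    lying in B and crossing the tensor sign. Carrying the structure of M back along the bijection
    realizes the prescribed formulas, and for any structure with these formulas Phi is a bijective
    morphism, hence an isomorphism ([phm_isomorphism_cancel]). *)

(** * Linear and bilinear maps, and sums over tensors *)

Section Linearity.
Variable k : fieldType.
Implicit Types U V W X : lmodType k.

Lemma bilinI U V W (f : U -> V -> W) :
  (forall v, linear (fun u => f u v)) -> (forall u, linear (fun v => f u v)) ->
  bilin f.
Proof. by move=> fl fr; split. Qed.

Lemma lin_id U : linear (fun x : U => x).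
Proof. by []. Qed.

Lemma lin_comp U V W (g : V -> W) (f : U -> V) :
  linear g -> linear f -> linear (fun x => g (f x)).
Proof. by move=> gl fl a x y; rewrite fl gl. Qed.

Lemma lin_map U V W (g : {linear V -> W}) (f : U -> V) :
  linear f -> linear (fun x => g (f x)).
Proof. by apply: lin_comp; exact: linearP. Qed.

Lemma lin_bl U V W X (B : V -> X -> W) (f : U -> V) c :
  bilin B -> linear f -> linear (fun x => B (f x) c).
Proof. by move=> Bl; apply: (lin_comp (Bl.1 c)). Qed.

Lemma lin_br U V W X (B : X -> V -> W) (f : U -> V) c :
  bilin B -> linear f -> linear (fun x => B c (f x)).
Proof. by move=> Bl; apply: (lin_comp (Bl.2 c)). Qed.

Lemma lin_scalel U V (f : U -> k) (c : V) :
  scalar f -> linear (fun x => f x *: c).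
Proof. by move=> fl a x y /=; rewrite fl scalerDl scalerA. Qed.

Lemma lin_scaler U V (f : U -> V) (c : k) :
  linear f -> linear (fun x => c *: f x).
Proof. by move=> fl a x y; rewrite fl scalerDr !scalerA mulrC. Qed.

Lemma lin_tfoldl U V W X (F : V -> X -> W) (t : U -> tensor V X) :
  bilin F -> linear t -> linear (fun x => tfold F (t x)).
Proof. by move=> /tfold_linear; exact: lin_comp. Qed.

Lemma lin_tfoldr U V W X (F : U -> V -> X -> W) (t : tensor V X) :
  (forall v y, linear (fun x => F x v y)) -> linear (fun x => tfold (F x) t).
Proof.
move=> Fl a x y; rewrite /tfold /tlift scaler_sumr -big_split /=.
by apply: eq_bigr => p _; rewrite Fl.
Qed.

(** Both sides sum over the same chosen representative of t, so summands are compared term by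
    term. *)
Lemma eq_tfold U V (W : zmodType) (f g : U -> V -> W) t :
  f =2 g -> tfold f t = tfold g t.
Proof. by move=> fg; apply: eq_bigr => p _. Qed.

Lemma raddf_tfold U V (W X : zmodType) (L : W -> X) (f : U -> V -> W) t :
  L 0 = 0 -> {morph L : x y / x + y} ->
  L (tfold f t) = tfold (fun u v => L (f u v)) t.
Proof. by move=> L0 LD; exact: (big_morph L LD L0). Qed.

Lemma lin_tfold U V W X (L : W -> X) (f : U -> V -> W) t :
  linear L -> L (tfold f t) = tfold (fun u v => L (f u v)) t.
Proof. by move=> Ll; apply: raddf_tfold; [exact: lin0 | exact: linD]. Qed.

Lemma tfold0 U V (W : zmodType) (t : tensor U V) :
  tfold (fun _ _ => 0 : W) t = 0.
Proof. by rewrite /tfold /tlift big1. Qed.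

Lemma eq_tfold0 U V (W : zmodType) (f : U -> V -> W) (t : tensor U V) :
  (forall u v, f u v = 0) -> tfold f t = 0.
Proof. by move=> f0; rewrite -[RHS](tfold0 W t); apply: eq_tfold. Qed.

Lemma exchange_tfold U V U' V' (W : zmodType)
  (f : U -> V -> U' -> V' -> W) (s : tensor U V) (t : tensor U' V') :
  tfold (fun u v => tfold (f u v) t) s
    = tfold (fun u' v' => tfold (fun u v => f u v u' v') s) t.
Proof. exact: exchange_big. Qed.

Lemma tfold_tens U V (t : tensor U V) : tfold (@tens k U V) t = t.
Proof.
have L := tfold_linear (tens_bilin U V).
elim/tensor_ind: t => [|x y Hx Hy|u v]; first exact: lin0 L.
  by rewrite (linD L) Hx Hy.
by rewrite tfoldE //; exact: tens_bilin.
Qed.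

Lemma tfold_tfold U V U' V' W (g : U' -> V' -> W) (f : U -> V -> tensor U' V') t :
  bilin g -> tfold g (tfold f t) = tfold (fun u v => tfold g (f u v)) t.
Proof. by move=> gB; apply: lin_tfold; exact: tfold_linear. Qed.

Lemma tfold_tmap U V U' V' W (F : U' -> V' -> W) (f : U -> U') (g : V -> V') t :
  bilin F -> tfold F (tmap f g t) = tfold (fun u v => F (f u) (g v)) t.
Proof.
by move=> FB; rewrite /tmap tfold_tfold //; apply: eq_tfold => u v; rewrite tfoldE.
Qed.

Lemma tfold_tmap2 U V U' V' U'' V'' W (F : U'' -> V'' -> W)
  (f : U -> U' -> U'') (g : V -> V' -> V'') s t :
  bilin F ->
  tfold F (tmap2 f g s t)
    = tfold (fun u v => tfold (fun u' v' => F (f u u') (g v v')) t) s.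
Proof.
move=> FB; rewrite /tmap2 tfold_tfold //; apply: eq_tfold => u v.
by rewrite tfold_tfold //; apply: eq_tfold => u' v'; rewrite tfoldE.
Qed.

End Linearity.

(** * Transport along equalities of degrees *)

Section Transport.
Variables (k : fieldType) (G : zmodType).

Lemma tr_linear (M : G -> lmodType k) a b (e : a = b) :
  linear (fun m : M a => tr M e m).
Proof. by case: b / e. Qed.

Lemma trM (A : G -> pzAlgType k) a b (e : a = b) (x y : A a) :
  tr A e (x * y) = tr A e x * tr A e y.
Proof. by case: b / e. Qed.

Lemma tr_one (A : G -> pzAlgType k) a b (e : a = b) : tr A e 1 = 1.
Proof. by case: b / e. Qed.

Lemma tr_tr (M : G -> Type) a b c (e : a = b) (e' : b = c) (m : M a) :
  tr M e' (tr M e m) = tr M (etrans e e') m.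
Proof. by case: c / e'; case: b / e. Qed.

Lemma tr_refl (M : G -> Type) a (e : a = a) (m : M a) : tr M e m = m.
Proof. by rewrite (eq_axiomK e). Qed.

End Transport.

(** * Sweedler notation with free degrees *)

Section Sweedler.
Variables (k : fieldType) (G : zmodType) (H : G -> pzAlgType k).
Variable hH : hopfGCoalg H.

(* tfold (fun n h => E n h) (sw cM e m) is E m_(0,a) m_(1,b) in Sweedler      *)
(* notation.  The index equation e : a + b = c absorbs all transports, so     *)
(* that coassociativity (sw_assoc) holds without any.                         *)
Definition sw (M : G -> lmodType k) (cM : comodule hH M) a b c (e : a + b = c)
    (m : M c) : tensor (M a) (H b) :=
  coact cM a b (tr M (esym e) m).

Definition swH a b c (e : a + b = c) (h : H c) : tensor (H a) (H b) :=
  sw (regular_comodule hH) e h.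

Lemma sw_linear M (cM : comodule hH M) a b c (e : a + b = c) : linear (sw cM e).
Proof. by move=> x y z; rewrite /sw tr_linear linearP. Qed.

Lemma lin_sw (U : lmodType k) M (cM : comodule hH M) a b c (e : a + b = c)
    (f : U -> M c) :
  linear f -> linear (fun x => sw cM e (f x)).
Proof. exact/lin_comp/sw_linear. Qed.

Lemma lin_swH (U : lmodType k) a b c (e : a + b = c) (f : U -> H c) :
  linear f -> linear (fun x => swH e (f x)).
Proof. exact/lin_comp/sw_linear. Qed.

Lemma lin_tens_l (U V W : lmodType k) (f : W -> U) (v : V) :
  linear f -> linear (fun x => tens (f x) v).
Proof. exact/lin_bl/tens_bilin. Qed.

Lemma lin_tens_r (U V W : lmodType k) (f : W -> V) (u : U) :
  linear f -> linear (fun x => tens u (f x)).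
Proof. exact/lin_br/tens_bilin. Qed.

Lemma lin_mull (U : lmodType k) (A : pzAlgType k) (f : U -> A) (c : A) :
  linear f -> linear (fun x => f x * c).
Proof. exact/lin_bl/pzmul_bilin. Qed.

Lemma lin_mulr (U : lmodType k) (A : pzAlgType k) (f : U -> A) (c : A) :
  linear f -> linear (fun x => c * f x).
Proof. exact/lin_br/pzmul_bilin. Qed.

Lemma pzscaleAl (A : pzAlgType k) (c : k) (x y : A) : c *: x * y = c *: (x * y).
Proof.
have L : linear (fun x : A => x * y) by apply: lin_mull.
by have := L c x 0; rewrite mul0r !addr0.
Qed.

Lemma pzscaleAr (A : pzAlgType k) (c : k) (x y : A) : x * (c *: y) = c *: (x * y).
Proof.
have L : linear (fun y : A => x * y) by apply: lin_mulr.
by have := L c y 0; rewrite mulr0 !addr0.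
Qed.

Lemma lin_counit (U : lmodType k) (f : U -> H 0) (V : lmodType k) (v : V) :
  linear f -> linear (fun x => counit hH (f x) *: v).
Proof. by move=> fl; apply: lin_scalel => a x y; rewrite fl linearP. Qed.

End Sweedler.

(** * The antipode and its inverse between opposite degrees *)

Section AntipodeMaps.
Variables (k : fieldType) (G : zmodType) (H : G -> pzAlgType k).
Variable hH : hopfGCoalg H.

(* The antipode S_a, and below its inverse, with b standing for - a. *)
Definition anti a b (e : a + b = 0) (h : H a) : H b :=
  tr H (addr0_eq e) (antipode hH a h).

Lemma anti_linear a b (e : a + b = 0) : linear (anti e).
Proof. by move=> x y z; rewrite /anti linearP tr_linear. Qed.

Lemma lin_anti (U : lmodType k) a b (e : a + b = 0) (f : U -> H a) :
  linear f -> linear (fun x => anti e (f x)).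
Proof. exact/lin_comp/anti_linear. Qed.

Hypothesis hS : antipode_bijective hH.

Definition antiV a b (e : a + b = 0) (h : H b) : H a :=
  antipodeV hH (tr H (esym (addr0_eq e)) h).

Lemma antiVK a b (e : a + b = 0) : cancel (antiV e) (anti e).
Proof.
move=> h; rewrite /anti /antiV; set h' := tr H (esym _) h.
have [g _ gK] := hS a.
have -> : antipode hH a (antipodeV hH h') = h'.
  by apply: (xgetPex 0 (P := [set x | antipode hH a x = h'])); exists (g h').
by rewrite /h' tr_tr tr_refl.
Qed.

Lemma anti_inj a b (e : a + b = 0) : injective (anti e).
Proof.
move=> x y; have b_eq := addr0_eq e; subst b.
by rewrite /anti !tr_refl => /(bij_inj (hS a)).
Qed.

Lemma antiV_linear a b (e : a + b = 0) : linear (antiV e).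
Proof.
by move=> c x y; apply: (anti_inj (e := e)); rewrite anti_linear !antiVK.
Qed.

Lemma lin_antiV (U : lmodType k) a b (e : a + b = 0) (f : U -> H b) :
  linear f -> linear (fun x => antiV e (f x)).
Proof. exact/lin_comp/antiV_linear. Qed.

End AntipodeMaps.

(** * Linearity of the actions *)

Section ActionMaps.
Variables (k : fieldType) (G : zmodType) (H : G -> pzAlgType k).
Variables (hH : hopfGCoalg H) (A : G -> poissonAlgType k).
Variables (hA : comodulePoissonAlg hH A) (M : G -> lmodType k).
Variable hM : poissonHopfModule hA M.

Lemma lin_act_l (U : lmodType k) a (f : U -> A a) m :
  linear f -> linear (fun x => act hM (f x) m).
Proof. exact/lin_bl/act_bilin. Qed.

Lemma lin_act_r (U : lmodType k) a (f : U -> M a) x :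
  linear f -> linear (fun m => act hM x (f m)).
Proof. exact/lin_br/act_bilin. Qed.

Lemma lin_lie_l (U : lmodType k) a (f : U -> A a) m :
  linear f -> linear (fun x => lie hM (f x) m).
Proof. exact/lin_bl/lie_bilin. Qed.

Lemma lin_lie_r (U : lmodType k) a (f : U -> M a) x :
  linear f -> linear (fun m => lie hM x (f m)).
Proof. exact/lin_br/lie_bilin. Qed.

(** The module structure of M_a (x) H_b over the algebra A_a (x) H_b; in these terms [coact_act]
    says that the coaction of x . m is the coaction of x acting on that of m. *)
Definition act2 a b : tensor (A a) (H b) -> tensor (M a) (H b) -> tensor (M a) (H b) :=
  tmap2 (@act _ _ _ _ _ _ _ hM a) (@pzmul k (H b)).

Lemma act2_bilin a b : bilin (@act2 a b).
Proof. by apply: tmap2_bilin; [exact: act_bilin | exact: pzmul_bilin]. Qed.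

Lemma act2E a b (x : A a) (h : H b) m h' :
  act2 (tens x h) (tens m h') = tens (act hM x m) (h * h').
Proof. by apply: tmap2E; [exact: act_bilin | exact: pzmul_bilin]. Qed.

Lemma lin_act2_l (U : lmodType k) a b (f : U -> tensor (A a) (H b)) m :
  linear f -> linear (fun x => act2 (f x) m).
Proof. exact/lin_bl/act2_bilin. Qed.

Lemma lin_act2_r (U : lmodType k) a b (f : U -> tensor (M a) (H b)) x :
  linear f -> linear (fun m => act2 x (f m)).
Proof. exact/lin_br/act2_bilin. Qed.

End ActionMaps.

(** Linearity is decided by the outermost operation of the body. The last case eta-expands a map
    that is not an abstraction, so that the other patterns can match it. *)
Ltac lin1 :=
  match goal with
  | |- GRing.linear_for _ (fun x => x) => exact: lin_id
  | |- GRing.linear_for _ (fun x => anti _ _ _) => apply: lin_anti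
  | |- GRing.linear_for _ (fun x => antiV _ _ _) => apply: lin_antiV
  | |- GRing.linear_for _ (fun x => sw _ _ _) => apply: lin_sw
  | |- GRing.linear_for _ (fun x => swH _ _ _) => apply: lin_swH
  | |- GRing.linear_for _ (fun x => tens _ _) =>
      first [apply: lin_tens_l | apply: lin_tens_r]
  | |- GRing.linear_for _ (fun x => (_ * _)%R) =>
      first [apply: lin_mull | apply: lin_mulr]
  | |- GRing.linear_for _ (fun x => act _ _ _) =>
      first [apply: lin_act_l | apply: lin_act_r]
  | |- GRing.linear_for _ (fun x => lie _ _ _) =>
      first [apply: lin_lie_l | apply: lin_lie_r]
  | |- GRing.linear_for _ (fun x => act2 _ _ _) =>
      first [apply: lin_act2_l | apply: lin_act2_r]
  | |- GRing.linear_for _ (fun x => tfold _ _) =>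
      first [apply: lin_tfoldl | apply: lin_tfoldr => ? ?]
  | |- GRing.linear_for _ (fun x => _ *: _) =>
      first [apply: lin_counit | apply: lin_scaler]
  | |- bilinear_for _ _ _ => apply: bilinI => ? /=
  | |- GRing.linear_for _ (fun x => GRing.Linear.sort _ _) => apply: lin_map
  | |- forall _, _ => move=> ?
  | |- GRing.linear_for ?s ?f =>
      lazymatch f with fun _ => _ => fail | _ =>
        change (GRing.linear_for s (fun x => f x)) end
  end.

Ltac lin := cbn beta; repeat (first [done | assumption | progress cbn beta | lin1 |
  match goal with
   L : _ |- GRing.linear_for _ _ => solve [apply: L]
  end]).

(** * Coassociativity and counit in Sweedler form *)

Section Coassociativity.
Variables (k : fieldType) (G : zmodType) (H : G -> pzAlgType k).
Variable hH : hopfGCoalg H.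
Variables (M : G -> lmodType k) (cM : comodule hH M).

Lemma tfold_tassoc (U V W X : lmodType k) (F : U -> V -> W -> X) y :
  (forall v w, linear (fun u => F u v w)) ->
  (forall u w, linear (fun v => F u v w)) ->
  (forall u v, linear (fun w => F u v w)) ->
  tfold (fun m hh => tfold (F m) hh) (tassoc y)
    = tfold (fun t h => tfold (fun m h' => F m h' h) t) y.
Proof.
move=> F1 F2 F3.
have B1 (w : W) : bilin (fun (u : U) (v : V) => tens u (tens v w)) by lin.
have B2 : bilin (fun m hh => tfold (F m) hh) by lin.
rewrite /tassoc tfold_tfold //; apply: eq_tfold => t w.
rewrite tfold_tfold //; apply: eq_tfold => u v.
by rewrite tfoldE // tfoldE //; lin.
Qed.

(** This is [coactA] evaluated against a trilinear F; once the composite degrees are substituted,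
    only the transport already present in [coactA] is left. *)
Lemma sw_assoc a b c ab bc abc (e1 : a + b = ab) (e2 : ab + c = abc)
  (e3 : b + c = bc) (e4 : a + bc = abc) (X : lmodType k)
  (F : M a -> H b -> H c -> X) m :
  (forall v w, linear (fun u => F u v w)) ->
  (forall u w, linear (fun v => F u v w)) ->
  (forall u v, linear (fun w => F u v w)) ->
  tfold (fun n h => tfold (fun m h' => F m h' h) (sw cM e1 n)) (sw cM e2 m)
    = tfold (fun m h => tfold (F m) (swH hH e3 h)) (sw cM e4 m).
Proof.
move=> F1 F2 F3; subst ab bc abc; rewrite /swH /sw.
rewrite (eq_irrelevance (esym e4) (esym (addrA a b c))).
have := congr1 (fun t => tfold (fun m hh => tfold (F m) hh) t) (coactA cM m).
rewrite tfold_tassoc // !tfold_tmap; first by [].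
- by lin.
- by lin.
Qed.

Lemma sw_counit a (e : a + 0 = a) (X : lmodType k) (f : M a -> X) m :
  linear f -> tfold (fun n h => counit hH h *: f n) (sw cM e m) = f m.
Proof.
move=> fl; rewrite -[in RHS](coact_counit cM m) (lin_tfold _ _ fl) /sw.
rewrite (eq_irrelevance (esym e) (esym (addr0 a))); apply: eq_tfold => n h.
by have := fl (counit hH h) n 0; rewrite (lin0 fl) !addr0.
Qed.

End Coassociativity.

(** * The antipode is unital and antimultiplicative *)

Section Antipode.
Variables (k : fieldType) (G : zmodType) (H : G -> pzAlgType k).
Variable hH : hopfGCoalg H.
Local Notation c := (counit hH).

Lemma swH_counitl a (e : 0 + a = a) (X : lmodType k) (f : H a -> X) m :
  linear f -> tfold (fun h n => c h *: f n) (swH hH e m) = f m.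
Proof.
move=> fl; rewrite -[in RHS](counitl hH m) (lin_tfold _ _ fl) /swH /sw.
rewrite (eq_irrelevance (esym e) (esym (add0r a))); apply: eq_tfold => h n.
by have := fl (c h) n 0; rewrite (lin0 fl) !addr0.
Qed.

Lemma swH_counitr a (e : a + 0 = a) (X : lmodType k) (f : H a -> X) m :
  linear f -> tfold (fun n h => c h *: f n) (swH hH e m) = f m.
Proof.
move=> fl; exact: (@sw_counit _ _ _ _ _ (regular_comodule hH) a e X f m fl).
Qed.

Lemma swHM a b ab (e : a + b = ab) (X : lmodType k) (F : H a -> H b -> X) (x y : H ab) :
  bilin F ->
  tfold F (swH hH e (x * y))
    = tfold (fun (x1 : H a) (x2 : H b) =>
        tfold (fun (y1 : H a) (y2 : H b) => F (x1 * y1) (x2 * y2)) (swH hH e y))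
        (swH hH e x).
Proof.
move=> FB; rewrite /swH /sw /= trM (comul_morph hH a b).2.
exact: tfold_tmap2.
Qed.

Lemma swH1 a b ab (e : a + b = ab) : swH hH e 1 = tens (1 : H a) (1 : H b).
Proof. by rewrite /swH /sw /= tr_one (comul_morph hH a b).1. Qed.

Lemma antil a b (e : a + b = 0) (h : H 0) :
  tfold (fun (x : H a) (y : H b) => anti hH e x * y) (swH hH e h) = c h *: (1 : H b).
Proof.
have ea : a = - b by rewrite (addr0_eq (etrans (addrC b a) e)).
subst a; rewrite -antipodel /swH /sw /anti.
rewrite (eq_irrelevance (esym e) (esym (addNr b))).
by rewrite (eq_irrelevance (addr0_eq e) (opprK b)).
Qed.

Lemma antir a b (e : a + b = 0) (e' : b + a = 0) (h : H 0) :
  tfold (fun (x : H a) (y : H b) => x * anti hH e' y) (swH hH e h) = c h *: (1 : H a).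
Proof.
have eb : b = - a by rewrite (addr0_eq e).
subst b; rewrite -antipoder /swH /sw /anti.
rewrite (eq_irrelevance (esym e) (esym (subrr a))).
by rewrite (eq_irrelevance (addr0_eq e') (opprK a)).
Qed.

Lemma anti1 a b (e : a + b = 0) : anti hH e 1 = 1.
Proof.
have := antil e 1; rewrite swH1 (counit_morph hH).1 scale1r => <-.
by rewrite tfoldE ?mulr1 //; lin.
Qed.

(* S y * S x and S (x y) are both convolution inverses of multiplication. *)
Lemma antiM a b (e : a + b = 0) (x y : H a) :
  anti hH e (x * y) = anti hH e y * anti hH e x.
Proof.
have e' : b + a = 0 by rewrite addrC.
(* Read from right to left, this replaces a counit by a product u S(v), which is how the extra
   factors enter below. *)
have Q w z : tfold (fun (u : H b) (v : H a) => w * (u * anti hH e v)) (swH hH e' z)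
    = c z *: w.
  have L : linear (fun v : H b => w * v) by lin.
  by rewrite -(lin_tfold _ _ L) antir pzscaleAr mulr1.
(* This summand collapses in two ways: contracting y_2 S(y_3) leaves S(x_1 y) x_2 ([PE]), while
   S(x_1 y_1) x_2 y_2, summed over x as well, is a counit and leaves S(y_3) (through [PE']). *)
pose F (x1 : H a) (x2 : H b) (y1 : H a) (y2 : H b) (y3 : H a) : H b :=
  anti hH e (x1 * y1) * (x2 * y2) * anti hH e y3.
pose P x1 x2 := tfold (fun y1 => fun z => tfold (F x1 x2 y1) (swH hH e' z))
  (swH hH (addr0 a) y).
have PE x1 x2 : P x1 x2 = anti hH e (x1 * y) * x2.
  have Ly : linear (fun y : H a => anti hH e (x1 * y) * x2) by lin.
  rewrite -(swH_counitr (addr0 a) y Ly) /P; apply: eq_tfold => y1 z.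
  rewrite -Q; apply: eq_tfold => y2 y3.
  by rewrite /F !mulrA.
have PF : P = fun x1 x2 => anti hH e (x1 * y) * x2.
  by apply/funext => x1; apply/funext => x2; exact: PE.
have PE' x1 x2 : P x1 x2 = tfold (fun z y3 => tfold (fun y1 y2 =>
    F x1 x2 y1 y2 y3) (swH hH e z)) (swH hH (add0r a) y).
  by rewrite /P [RHS](sw_assoc _ _ _ e' (addr0 a)) //; rewrite /F; lin.
have Lx : linear (fun x : H a => anti hH e (x * y)) by lin.
rewrite -(swH_counitr (addr0 a) x Lx).
transitivity (tfold (fun x1 z => tfold (fun x2 x3 => P x1 x2 * anti hH e x3)
    (swH hH e' z)) (swH hH (addr0 a) x)).
  apply: eq_tfold => x1 z; rewrite -Q; apply: eq_tfold => x2 x3.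
  by rewrite PE mulrA.
transitivity (tfold (fun z x3 => tfold (fun x1 x2 => P x1 x2 * anti hH e x3)
    (swH hH e z)) (swH hH (add0r a) x)).
  symmetry; apply: (sw_assoc (regular_comodule hH)) => [v w|v w|v w].
  - by rewrite PF; lin.
  - by rewrite PF; lin.
  - by lin.
have L : linear (fun x => anti hH e y * anti hH e x) by lin.
rewrite -[RHS](swH_counitl (add0r a) x L).
apply: eq_tfold => z x3.
have Lm : linear (fun w : H b => w * anti hH e x3) by lin.
rewrite -(lin_tfold _ _ Lm) -pzscaleAl; congr (_ * _).
under eq_tfold => x1 x2 do rewrite PE'.
rewrite exchange_tfold.
have La : linear (fun y => c z *: anti hH e y) by lin.
rewrite -[RHS](swH_counitl (add0r a) y La); apply: eq_tfold => z' y3.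
(* The comultiplication is multiplicative, so the parts of z and z' combine into those of z z', to
   which the antipode axiom applies. *)
transitivity (tfold (fun u v => anti hH e u * v * anti hH e y3) (swH hH e (z * z'))).
  by rewrite swHM //; lin.
have Ly : linear (fun w : H b => w * anti hH e y3) by lin.
rewrite -(lin_tfold _ _ Ly) antil (counit_morph hH).2 pzscaleAl mul1r.
by rewrite mulrC scalerA.
Qed.

End Antipode.

(** * Identities for the inverse antipode *)

Section AntipodeInverse.
Variables (k : fieldType) (G : zmodType) (H : G -> pzAlgType k).
Variables (hH : hopfGCoalg H) (hS : antipode_bijective hH).

Lemma antiV1 a b (e : a + b = 0) : antiV hH e 1 = 1.
Proof. by apply: (anti_inj hS (e := e)); rewrite (antiVK hS) anti1. Qed.

Lemma antiVM a b (e : a + b = 0) x y : antiV hH e (x * y) = antiV hH e y * antiV hH e x.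
Proof. by apply: (anti_inj hS (e := e)); rewrite antiM !(antiVK hS). Qed.

(** S sends S'(h_2) h_1 to S(h_1) h_2, so the antipode axiom passes to S' with the factors
    exchanged. *)
Lemma antiVl a b (e : a + b = 0) (h : H 0) :
  tfold (fun (x : H a) (y : H b) => antiV hH e y * x) (swH hH e h)
    = counit hH h *: (1 : H a).
Proof.
apply: (anti_inj hS (e := e)); have L := anti_linear hH e.
rewrite (lin_tfold _ _ L) -[counit hH h *: _]addr0 L (lin0 L) addr0 anti1 -(antil hH e).
by apply: eq_tfold => x y; rewrite antiM (antiVK hS).
Qed.

Lemma antiVr a b (e : a + b = 0) (e' : b + a = 0) (h : H 0) :
  tfold (fun (x : H b) (y : H a) => y * antiV hH e x) (swH hH e' h)
    = counit hH h *: (1 : H a).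
Proof.
apply: (anti_inj hS (e := e)); have L := anti_linear hH e.
rewrite (lin_tfold _ _ L) -[counit hH h *: _]addr0 L (lin0 L) addr0 anti1.
by rewrite -(antir hH e' e); apply: eq_tfold => x y; rewrite antiM (antiVK hS).
Qed.

End AntipodeInverse.

(** * Coactions of products and of coinvariant families *)

Section ComoduleAction.
Variables (k : fieldType) (G : zmodType) (H : G -> pzAlgType k).
Variables (hH : hopfGCoalg H) (A : G -> poissonAlgType k).
Variables (hA : comodulePoissonAlg hH A) (M : G -> lmodType k).
Variable hM : poissonHopfModule hA M.

Lemma sw_act a b ab (e : a + b = ab) (X : lmodType k) (F : M a -> H b -> X)
    (x : A ab) (m : M ab) : bilin F ->
  tfold F (sw hM e (act hM x m))
    = tfold (fun x0 (x1 : H b) => tfold (fun m0 (m1 : H b) => F (act hM x0 m0) (x1 * m1))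
        (sw hM e m)) (sw hA e x).
Proof. by move=> FB; subst ab; rewrite /sw coact_act tfold_tmap2. Qed.

Lemma sw_lie a b ab (e : a + b = ab) (X : lmodType k) (F : M a -> H b -> X)
    (x : A ab) (m : M ab) : bilin F ->
  tfold F (sw hM e (lie hM x m))
    = tfold (fun x0 (x1 : H b) => tfold (fun m0 (m1 : H b) => F (lie hM x0 m0) (x1 * m1))
        (sw hM e m)) (sw hA e x).
Proof. by move=> FB; subst ab; rewrite /sw coact_lie tfold_tmap2. Qed.

Lemma sw_coinv (m : forall a, M a) a b ab (e : a + b = ab) :
  coinv_family hM m -> sw hM e (m ab) = tens (m a) (1 : H b).
Proof. by move=> mF; subst ab; rewrite /sw mF. Qed.

Lemma act2M a b (x y : tensor (A a) (H b)) t :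
  act2 hM (x * y) t = act2 hM x (act2 hM y t).
Proof.
have B := act2_bilin hM a b.
elim/tensor_ind: t => [|t t' IH IH'|m h].
- by rewrite !(lin0 (B.2 _)).
- by rewrite !(linD (B.2 _)) IH IH'.
elim/tensor_ind: y => [|y y' IH IH'|y h'].
- by rewrite mulr0 (lin0 (B.1 _)) (lin0 (B.2 _)).
- by rewrite mulrDr !(linD (B.1 _)) (linD (B.2 _)) IH IH'.
elim/tensor_ind: x => [|x x' IH IH'|x h''].
- by rewrite mul0r !(lin0 (B.1 _)).
- by rewrite mulrDl !(linD (B.1 _)) IH IH'.
by rewrite tens_mul !act2E actM mulrA.
Qed.

Lemma act2_1 a b (t : tensor (M a) (H b)) : act2 hM 1 t = t.
Proof.
have B := act2_bilin hM a b.
elim/tensor_ind: t => [|t t' IH IH'|m h].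
- by rewrite !(lin0 (B.2 _)).
- by rewrite !(linD (B.2 _)) IH IH'.
by rewrite act2E act1 mul1r.
Qed.

End ComoduleAction.

(** * The projection onto coinvariants *)

Section Projection.
Variables (k : fieldType) (G : zmodType) (H : G -> pzAlgType k).
Variables (hH : hopfGCoalg H) (hS : antipode_bijective hH).
Variables (A : G -> poissonAlgType k) (hA : comodulePoissonAlg hH A).
Variable phi : forall a, {linear H a -> A a}.
Hypothesis hphi : poisson_central_map hA phi.
Variables (M : G -> lmodType k) (hM : poissonHopfModule hA M).

Local Notation c := (counit hH).
Local Notation p := (coinv_proj phi hM).
Local Notation S' a := (antiV hH (subrr a)).

Lemma phi1 a : phi a 1 = 1.
Proof. by case: hphi => /(_ a)[]. Qed.

Lemma phiM a x y : phi a (x * y) = phi a x * phi a y.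
Proof. by case: hphi => /(_ a)[_ ->]. Qed.

Lemma phi_scale1 a (r : k) : phi a (r *: (1 : H a)) = r *: (1 : A a).
Proof. by rewrite linearZ phi1. Qed.

Lemma coinv_projE a n :
  p a n = tfold (fun m0 m1 => act hM (phi a (S' a m1)) m0) (sw hM (subrr a) n).
Proof.
apply: eq_tfold => m0 m1; rewrite /antiV (eq_irrelevance (addr0_eq _) erefl).
by [].
Qed.

Lemma coinv_proj_linear a : linear (p a).
Proof.
have : linear (fun n => tfold (fun m0 m1 => act hM (phi a (S' a m1)) m0)
    (sw hM (subrr a) n)) by lin.
by move=> L x y z; rewrite !coinv_projE L.
Qed.

Lemma act_scale1 a (r : k) (m : M a) : act hM (r *: (1 : A a)) m = r *: m.
Proof.
have L : linear (fun x => act hM x m) by lin.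
by rewrite -[r *: (1 : A a)]addr0 L (lin0 L) addr0 act1.
Qed.

(** In the Leibniz rule the term {x, phi(h)} . m vanishes, since phi takes values in the Poisson
    centre. *)
Lemma lie_phi a h (m : M a) x :
  lie hM x (act hM (phi a h) m) = act hM (phi a h) (lie hM x m).
Proof.
case: hphi => _ _ /(_ a h x) /= E; rewrite lie_act E.
by rewrite (lin0 ((act_bilin hM a).1 _)) add0r.
Qed.

Lemma sw_phi a b ab (e : a + b = ab) (h : H ab) :
  sw hA e (phi ab h) = tmap (phi a) id (swH hH e h).
Proof. by subst ab; case: hphi => _ C _; rewrite /sw C. Qed.

(** By coassociativity the left side is the sum of phi(m_2 S'(m_1)) . m_0, and [antiVr] contracts
    m_2 S'(m_1) to a counit. *)
Lemma coinv_proj_reconstruct a (m : M a) :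
  tfold (fun n h => act hM (phi a h) (p a n)) (sw hM (add0r a) m) = m.
Proof.
transitivity (tfold (fun n (h : H a) => tfold (fun x y =>
    act hM (phi a (h * S' a y)) x) (sw hM (subrr a) n)) (sw hM (add0r a) m)).
  apply: eq_tfold => n h; rewrite coinv_projE.
  have L : linear (fun m => act hM (phi a h) m) by lin.
  by rewrite (lin_tfold _ _ L); apply: eq_tfold => x y; rewrite phiM actM.
rewrite (sw_assoc _ _ _ (addNr a) (addr0 a) (F := fun x y (z : H a) =>
  act hM (phi a (z * S' a y)) x)); try by lin.
rewrite -[RHS](sw_counit hM (addr0 a) (f := id)) //; apply: eq_tfold => x h.
have L : linear (fun z => act hM (phi a z) x) by lin.
by rewrite -(lin_tfold _ _ L) antiVr // phi_scale1 act_scale1.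
Qed.

(* X is recovered from g * X = coact, where g := coact o phi, by convolving   *)
(* with coact o phi o S', the convolution inverse of g.                       *)
Lemma convolution_inj a b (X : M 0 -> tensor (M a) (H b)) n :
  linear X ->
  (forall m, tfold (fun n h => act2 hM (coact hA a b (phi (a + b) h)) (X n))
    (sw hM (add0r (a + b)) m) = coact hM a b m) ->
  X n = tfold (fun m h =>
      act2 hM (coact hA a b (phi (a + b) (S' (a + b) h))) (coact hM a b m))
    (sw hM (subrr (a + b)) n).
Proof.
move=> XL XE; set ab := a + b; pose gT h := coact hA a b (phi ab (S' ab h)).
(* The right-hand side with the coaction of m expanded by [XE]; after coassociativity [antiVl]
   contracts the product of S'(h) and u. *)
transitivity (tfold (fun m h => tfold (fun n u =>
    act2 hM (coact hA a b (phi ab (S' ab h * u))) (X n)) (sw hM (add0r ab) m))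
    (sw hM (subrr ab) n)); last first.
  apply: eq_tfold => m h; rewrite -XE.
  have L : linear (fun t => act2 hM (gT h) t) by lin.
  rewrite (lin_tfold _ _ L); apply: eq_tfold => n' u.
  by rewrite phiM (cpa_coact_morph hA a b).2 act2M.
rewrite (sw_assoc _ _ _ (subrr ab) (addr0 0) (F := fun n (u : H ab) h =>
  act2 hM (coact hA a b (phi ab (S' ab h * u))) (X n))); try by lin.
rewrite -[LHS](sw_counit hM (addr0 0) n XL); apply: eq_tfold => m z.
have L : linear (fun u => act2 hM (coact hA a b (phi ab u)) (X m)) by lin.
rewrite -(lin_tfold _ _ L) antiVl //.
rewrite -[c z *: (1 : H ab)]addr0 L (lin0 L) phi1 addr0.
by rewrite (cpa_coact_morph hA a b).1 act2_1.
Qed.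

(** [convolution_inj] computes both sides by the same formula. Its hypothesis is, for the left side,
    the coaction applied to [coinv_proj_reconstruct], and for the right side it follows from the
    colinearity of phi and reconstruction in degree a. *)
Lemma coinv_proj_coact a b n :
  coact hM a b (p (a + b) n) = tens (p a n) (1 : H b).
Proof.
have pL d := coinv_proj_linear d.
rewrite (convolution_inj (X := fun n => coact hM a b (p (a + b) n))); last 2 first.
- by lin.
- move=> m; rewrite -[in RHS](coinv_proj_reconstruct m).
  by rewrite (lin_tfold _ _ (linearP _)); apply: eq_tfold => n' h; rewrite coact_act.
symmetry; apply: (convolution_inj (X := fun n => tens (p a n) (1 : H b))); first by lin.
move=> m; transitivity (tfold (fun n' h => tfold (fun u v =>
    tens (act hM (phi a u) (p a n')) v) (swH hH erefl h))
    (sw hM (add0r (a + b)) m)).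
  apply: eq_tfold => n' h.
  have -> : coact hA a b (phi (a + b) h) = tmap (phi a) id (swH hH erefl h).
    by rewrite -sw_phi.
  rewrite /tmap; have L : linear (fun t => act2 hM t (tens (p a n') (1 : H b))) by lin.
  rewrite (lin_tfold _ _ L); apply: eq_tfold => u v.
  by rewrite act2E mulr1.
rewrite -(sw_assoc _ (add0r a) erefl); try by lin.
rewrite -[RHS]tfold_tens; apply: eq_tfold => m' v.
have L : linear (fun m : M a => tens m v) by lin.
by rewrite -(lin_tfold _ _ L) coinv_proj_reconstruct.
Qed.

Lemma coinv_coinv_proj a n : coinv hM (p a n).
Proof. by exists (fun b => p b n) => // b d; exact: coinv_proj_coact. Qed.

(** The coaction of f_0 is f_a (x) 1 and phi(S'(1)) = 1. Thus every coinvariant lies in the image of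
    the projection. *)
Lemma coinv_proj_coinv (f : forall a, M a) a : coinv_family hM f -> p a (f 0) = f a.
Proof.
move=> fF; rewrite coinv_projE (sw_coinv _ fF) tfoldE; last by lin.
by rewrite antiV1 // phi1 act1.
Qed.

(** As f_0 coacts by f_a (x) 1, the twist by phi(S') falls entirely on x and produces the projection
    of x in A. *)
Lemma coinv_proj_act (f : forall a, M a) a (x : A 0) : coinv_family hM f ->
  p a (act hM x (f 0)) = act hM (coinv_proj phi (regular_phm hA) a x) (f a).
Proof.
move=> fF; rewrite coinv_projE sw_act; last by lin.
rewrite /coinv_proj /= (lin_tfold _ _ ((act_bilin hM a).1 (f a))).
apply: eq_tfold => x0 x1; rewrite (sw_coinv _ fF) tfoldE; last by lin.
by rewrite mulr1 -actM /antiV (eq_irrelevance (addr0_eq _) erefl).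
Qed.

Hypothesis trivM : trivial_lie' phi hM.

(** Triviality speaks only of A_e. An x in A_a is reduced to it by x <> p_a(n) = phi_a(x_1) .
    p_a(x_0 <> n) with x_0 in A_e, where every term vanishes. *)
Lemma coinv_proj_invariant a n : Defs.invariant hM (p a n).
Proof.
move=> x; rewrite coinv_projE (lin_tfold _ _ ((lie_bilin hM a).2 x)).
under eq_tfold => m0 m1 do rewrite lie_phi.
have pL := coinv_proj_linear a.
transitivity (tfold (fun x0 x1 => act hM (phi a x1) (p a (lie hM x0 n)))
    (sw hA (add0r a) x)); last first.
  apply: eq_tfold0 => x0 x1.
  have -> : p a (lie hM x0 n) = 0.
    by apply: (@trivM a x0) (coinv_coinv_proj a n) _; exists n.
  exact: lin0 ((act_bilin hM a).2 _).
pose F (x0 : A a) (x1 : H (- a)) (x2 : H a) := tfold (fun m0 m1 =>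
  act hM (phi a (x2 * S' a x1)) (act hM (phi a (S' a m1)) (lie hM x0 m0)))
  (sw hM (subrr a) n).
transitivity (tfold (fun x' x2 => tfold (fun x0 x1 => F x0 x1 x2)
    (sw hA (subrr a) x')) (sw hA (add0r a) x)); last first.
  apply: eq_tfold => x' x2.
  rewrite coinv_projE sw_lie; last by lin.
  have L : linear (fun m => act hM (phi a x2) m) by lin.
  rewrite (lin_tfold _ _ L); apply: eq_tfold => x0 x1.
  rewrite /F (lin_tfold _ _ L); apply: eq_tfold => m0 m1.
  (* S'(x_1 m_1) = S'(m_1) S'(x_1); commutativity of A_a then brings phi(S'(x_1)) next to phi(x_2),
     ready for [antiVr]. *)
  rewrite antiVM // !phiM !actM; congr (act _ _ _); rewrite -!actM.
  by congr (act _ _ _); rewrite mulrC.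
rewrite (sw_assoc _ _ _ (addNr a) (addr0 a)); try by rewrite /F; lin.
pose f x := tfold (fun m0 m1 => act hM (phi a (S' a m1)) (lie hM x m0))
  (sw hM (subrr a) n).
have fL : linear f by rewrite /f; lin.
rewrite -[LHS](sw_counit hA (addr0 a) x fL); apply: eq_tfold => x0 z.
rewrite /F exchange_tfold /f -[in LHS](act_scale1 _ (tfold _ _)).
have L : linear (fun m => act hM (c z *: (1 : A a)) m) by lin.
rewrite (lin_tfold _ _ L); apply: eq_tfold => m0 m1.
have L' : linear (fun z => act hM (phi a z)
  (act hM (phi a (S' a m1)) (lie hM x0 m0))) by lin.
by rewrite -(lin_tfold _ _ L') antiVr // phi_scale1.
Qed.

End Projection.

(** * Bilinearity of the induced module and linearity of Phi *)

Section Induced.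
Variables (k : fieldType) (G : zmodType) (H : G -> pzAlgType k).
Variables (hH : hopfGCoalg H).
Variables (A : G -> poissonAlgType k) (hA : comodulePoissonAlg hH A).
Variables (M : G -> lmodType k) (hM : poissonHopfModule hA M).

Lemma acoinv_val_linear a : linear (@acoinv_val _ _ _ _ _ _ _ hM a).
Proof. exact: (linearP (val : acoinvType hM a -> M a)). Qed.

Lemma acoinv_val_inj a : injective (@acoinv_val _ _ _ _ _ _ _ hM a).
Proof. exact: val_inj. Qed.

End Induced.

Section InducedBilin.
Variables (k : fieldType) (G : zmodType) (H : G -> pzAlgType k).
Variables (hH : hopfGCoalg H).
Variables (A : G -> poissonAlgType k) (hA : comodulePoissonAlg hH A).
Variables (M : G -> lmodType k) (hM : poissonHopfModule hA M).

(** The units form a coinvariant family because coactions are unital, and the Leibniz rule at 1 = 1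
    1 gives {x, 1} = {x, 1} + {x, 1}. *)
Lemma one_acoinv a : (1 : A a) \in @acoinv _ _ _ _ _ _ _ (regular_phm hA) a.
Proof.
apply/asboolP; split.
  by exists (fun b => 1 : A b) => // b d; exact: (cpa_coact_morph hA b d).1.
move=> x /=; have := poissonM x (1 : A a) 1.
by rewrite -![pzmul _ _]/(_ * _) !mul1r mulr1 -{1}[poisson x 1]addr0 => /addrI.
Qed.

Lemma itens_bilin a : bilin (@itens _ _ _ _ _ _ _ hM a).
Proof.
apply: bilinI => [m r x y|x r m m'].
  by rewrite /itens btensDl btensZl.
rewrite /itens btensDr; congr (_ + _).
(* Scalars act on the induced module through A_a; r times the unit, as an element of B_a, carries r
   across the tensor sign. *)
pose b := r *: (Acoinv (one_acoinv a) : baseAlg hA a).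
have -> : r *: m = base_act b m.
  by apply: acoinv_val_inj; rewrite /= act_scale1.
rewrite -btens_bal /= -btensZl; congr btens.
by rewrite /base_mulr /= pzscaleAr mulr1.
Qed.

Lemma induced_map_linear a : linear (@induced_map _ _ _ _ _ _ _ hM a).
Proof.
apply: tlift_linear => [m|x m m'|b x m] /=.
- exact: (act_bilin hM a).1.
- exact: (linD ((act_bilin hM a).2 x)).
- exact: actM.
Qed.

End InducedBilin.

(** * The inverse of Phi *)

Section Inverse.
Variables (k : fieldType) (G : zmodType) (H : G -> pzAlgType k).
Variables (hH : hopfGCoalg H) (hS : antipode_bijective hH).
Variables (A : G -> poissonAlgType k) (hA : comodulePoissonAlg hH A).
Variable phi : forall a, {linear H a -> A a}.
Hypothesis hphi : poisson_central_map hA phi.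

Section AcoinvProjection.
Variables (M : G -> lmodType k) (hM : poissonHopfModule hA M).
Hypothesis trivM : trivial_lie' phi hM.

(** A coinvariant is the projection of the degree 0 component of its family. *)
Lemma coinv_invariant a (m : M a) : coinv hM m -> Defs.invariant hM m.
Proof.
case=> f fF <- x; rewrite -(coinv_proj_coinv hS hphi a fF).
exact: coinv_proj_invariant.
Qed.

Lemma coinv_acoinv a (m : M a) : coinv hM m -> m \in @acoinv _ _ _ _ _ _ _ hM a.
Proof. by move=> mC; apply/asboolP; split=> //; exact: coinv_invariant. Qed.

Definition acoinv_proj a (n : M 0) : acoinvType hM a :=
  Acoinv (coinv_acoinv (coinv_coinv_proj hS hphi hM a n)).

Lemma acoinv_proj_linear a : linear (acoinv_proj a).
Proof.
move=> c x y; apply: acoinv_val_inj.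
by rewrite acoinv_val_linear /= coinv_proj_linear.
Qed.

Definition induced_inv a (m : M a) : induced hM a :=
  tfold (fun n h => itens (phi a h) (acoinv_proj a n)) (sw hM (add0r a) m).

Lemma induced_invK a : cancel (@induced_inv a) (@induced_map _ _ _ _ _ _ _ hM a).
Proof.
move=> m; have L : linear (@induced_map _ _ _ _ _ _ _ hM a) by exact: induced_map_linear.
rewrite (lin_tfold _ _ L).
rewrite -[RHS](coinv_proj_reconstruct hS hphi hM); apply: eq_tfold => n h.
by rewrite induced_mapE.
Qed.

End AcoinvProjection.

Variables (M : G -> lmodType k) (hM : poissonHopfModule hA M).
Hypothesis trivM : trivial_lie' phi hM.
Hypothesis trivA : trivial_lie' phi (regular_phm hA).

Lemma induced_inv_linear a : linear (induced_inv trivM (a := a)).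
Proof.
have iB := itens_bilin hM a.
have pL := acoinv_proj_linear trivM a.
apply: lin_tfoldl; last exact: sw_linear.
apply: bilinI => [h|n]; first exact: lin_br iB pL.
by apply: (lin_bl _ iB); exact: linearP.
Qed.

(** By [coinv_proj_act] the image is a sum of terms phi(x_1) (x) b . m with b the projection of x_0
    in A. Triviality for A puts b in B_a, so it moves to the left factor, where reconstruction in A
    sums the phi(x_1) b to x. *)
Lemma induced_inv_act a (x : A a) (m : acoinvType hM a) :
  induced_inv trivM (act hM x (acoinv_val m)) = itens x m.
Proof.
have iB := itens_bilin hM a.
have pL := acoinv_proj_linear trivM a.
have FB : bilin (fun n h => itens (phi a h) (acoinv_proj trivM a n)).
  apply: bilinI => [h|n]; first exact: lin_br iB pL.
  by apply: (lin_bl _ iB); exact: linearP.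
have [[f fF fE] _] : coinv hM (acoinv_val m) /\ Defs.invariant hM (acoinv_val m).
  by case: m => m mP; apply/asboolP.
rewrite /induced_inv sw_act //.
rewrite -[in RHS](coinv_proj_reconstruct hS hphi (regular_phm hA) x).
have L : linear (fun x => itens x m) := iB.1 m.
rewrite (lin_tfold _ _ L); apply: eq_tfold => x0 x1.
rewrite -fE (sw_coinv _ fF) tfoldE; last first.
  apply: bilinI => [h|n].
    by apply: (lin_br _ iB); apply: lin_comp pL _; exact: (act_bilin hM 0).2.
  by apply: (lin_bl _ iB); apply: lin_map; exact: pzmul_bilin.2.
rewrite mulr1.
have -> : acoinv_proj trivM a (act hM x0 (f 0)) = base_act (acoinv_proj trivA a x0) m.
  by apply: acoinv_val_inj; rewrite /= (coinv_proj_act hS _ _ _ fF) fE.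
exact: esym (@btens_bal k (A a) _ _
  (fun b => base_mulr b : {linear A a -> A a}) _ (acoinv_proj trivA a x0) (phi a x1) m).
Qed.

Lemma induced_mapK a :
  cancel (@induced_map _ _ _ _ _ _ _ hM a) (induced_inv trivM (a := a)).
Proof.
have L : linear (fun t => induced_inv trivM (@induced_map _ _ _ _ _ _ _ hM a t)).
  apply: lin_comp; [exact: induced_inv_linear | exact: induced_map_linear].
elim/btens_ind => [|t t' IH IH'|x m]; first exact: lin0 L.
  by rewrite (linD L) IH IH'.
by rewrite [induced_map _]induced_mapE induced_inv_act.
Qed.

End Inverse.

(** * Transport of the Hopf module structure along bijections *)

Section TransportStructure.
Variables (k : fieldType) (G : zmodType) (H : G -> pzAlgType k).
Variables (hH : hopfGCoalg H).
Variables (A : G -> poissonAlgType k) (hA : comodulePoissonAlg hH A).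
Variables (M : G -> lmodType k) (hM : poissonHopfModule hA M).
Variables (N : G -> lmodType k).
Variables (f : forall a, {linear N a -> M a}) (g : forall a, {linear M a -> N a}).
Hypotheses (fK : forall a, cancel (f a) (g a)) (gK : forall a, cancel (g a) (f a)).

(* Carrying the structure of M along the bijections f gives the structure on  *)
(* the induced module without checking that its operations respect the        *)
(* relations of the balanced tensor product.                                  *)
Definition transport_coact a b (n : N (a + b)) : tensor (N a) (H b) :=
  tmap (g a) id (coact hM a b (f (a + b) n)).

Lemma transport_coact_linear a b : linear (@transport_coact a b).
Proof. by rewrite /transport_coact /tmap; lin. Qed.

HB.instance Definition _ a b :=
  GRing.isLinear.Build k (N (a + b)) (tensor (N a) (H b)) *:%R
    (@transport_coact a b) (@transport_coact_linear a b).

Lemma tassoc_tfold (U V W : lmodType k) (y : tensor (tensor U V) W) :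
  tassoc y = tfold (fun t w => tfold (fun u v => tens u (tens v w)) t) y.
Proof.
rewrite -[LHS]tfold_tens -tfold_tassoc; try by lin.
apply: eq_tfold => u t; have L : linear (fun t : tensor V W => tens u t) by lin.
by rewrite -(lin_tfold _ _ L) tfold_tens.
Qed.

Lemma tr_linear_map a b (e : a = b) n : f b (tr N e n) = tr M e (f a n).
Proof. by case: b / e. Qed.

Lemma transport_coactA a b c (n : N (a + b + c)) :
  tassoc (tmap (transport_coact (b := b)) id (transport_coact (b := c) n))
    = tmap id (comul hH b c)
        (transport_coact (b := b + c) (tr N (esym (addrA a b c)) n)).
Proof.
rewrite tassoc_tfold tfold_tmap; last by lin.
rewrite {1}/transport_coact tfold_tmap; last by rewrite /transport_coact /tmap; lin.
(* f and g cancel between the two coactions, leaving the iterated coaction of M. *)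
transitivity (tfold (fun m h => tfold (fun m' h' =>
    tens (g a m') (tens h' (h : H c))) (sw hM erefl m)) (sw hM erefl (f _ n))).
  apply: eq_tfold => m h; rewrite /transport_coact gK tfold_tmap //.
  by lin.
rewrite (sw_assoc hM erefl erefl erefl (addrA a b c)
  (F := fun m' h' h => tens (g a m') (tens h' h))); try by lin.
rewrite /transport_coact [RHS]tfold_tmap; last by lin.
rewrite tr_linear_map /sw; apply: eq_tfold => m h.
have L : linear (fun t : tensor (H b) (H c) => tens (g a m) t) by lin.
by rewrite -(lin_tfold _ _ L) tfold_tens.
Qed.

Lemma transport_coact_counit a (n : N a) :
  tfold (fun x h => counit hH h *: x)
    (transport_coact (b := 0) (tr N (esym (addr0 a)) n)) = n.
Proof.
rewrite /transport_coact tfold_tmap; last by lin.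
rewrite tr_linear_map -[RHS]fK.
have L : linear (fun m => g a m) by lin.
by rewrite -[RHS](sw_counit hM (addr0 a) _ L).
Qed.

Definition transport_comodule : comodule hH N :=
  {| coact := fun a b => @transport_coact a b : {linear _ -> _};
     coactA := transport_coactA; coact_counit := transport_coact_counit |}.

(** With B the action or the Lie action, this carries [coact_act] and [coact_lie] over to N. *)
Lemma transport_coact_tmap2 a b (B : A a -> M a -> M a) s (m : M (a + b)) :
  bilin B ->
  tmap (g a) id (tmap2 B (@pzmul k (H b)) s (coact hM a b m))
    = tmap2 (fun x n => g a (B x (f a n))) (@pzmul k (H b)) s
        (transport_coact (b := b) (g _ m)).
Proof.
move=> BB; have LB x : linear (B x) := BB.2 x.
have tB : bilin (fun u v => tens (g a u) (v : H b)) by lin.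
rewrite /tmap tfold_tmap2 // /tmap2; apply: eq_tfold => x h.
rewrite /transport_coact gK tfold_tmap; last first.
  apply: bilinI => [v|n]; last by apply: lin_tens_r; exact: pzmul_bilin.2.
  by apply: lin_tens_l; apply: lin_map; apply: lin_comp (LB x) _; exact: linearP.
by apply: eq_tfold => m' h'; rewrite gK.
Qed.

Definition transport_act a (x : A a) (n : N a) : N a := g a (act hM x (f a n)).
Definition transport_lie a (x : A a) (n : N a) : N a := g a (lie hM x (f a n)).

Lemma transport_act_bilin a : bilin (@transport_act a).
Proof. by rewrite /transport_act; lin. Qed.

Lemma transport_act1 a (n : N a) : transport_act 1 n = n.
Proof. by rewrite /transport_act act1 fK. Qed.

Lemma transport_actM a (x y : A a) (n : N a) :
  transport_act (x * y) n = transport_act x (transport_act y n).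
Proof. by rewrite /transport_act gK actM. Qed.

Lemma transport_lie_bilin a : bilin (@transport_lie a).
Proof. by rewrite /transport_lie; lin. Qed.

Lemma transport_lie_poisson a (x y : A a) (n : N a) :
  transport_lie (poisson x y) n
    = transport_lie x (transport_lie y n) - transport_lie y (transport_lie x n).
Proof. by rewrite /transport_lie !gK lie_poisson raddfB. Qed.

Lemma transport_lie_act a (x y : A a) (n : N a) :
  transport_lie x (transport_act y n)
    = transport_act (poisson x y) n + transport_act y (transport_lie x n).
Proof. by rewrite /transport_lie /transport_act !gK lie_act raddfD. Qed.

Lemma transport_lie_mul a (x y : A a) (n : N a) :
  transport_lie (x * y) n
    = transport_act x (transport_lie y n) + transport_act y (transport_lie x n).
Proof. by rewrite /transport_lie /transport_act !gK lie_mul raddfD. Qed.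

Lemma transport_coact_act a b (x : A (a + b)) (n : N (a + b)) :
  transport_coact (transport_act x n)
    = tmap2 (@transport_act a) (@pzmul k (H b)) (coact hA a b x) (transport_coact n).
Proof.
rewrite /transport_coact {1}/transport_act gK coact_act.
rewrite transport_coact_tmap2; last exact: act_bilin.
by rewrite /transport_coact gK.
Qed.

Lemma transport_coact_lie a b (x : A (a + b)) (n : N (a + b)) :
  transport_coact (transport_lie x n)
    = tmap2 (@transport_lie a) (@pzmul k (H b)) (coact hA a b x) (transport_coact n).
Proof.
rewrite /transport_coact {1}/transport_lie gK coact_lie.
rewrite transport_coact_tmap2; last exact: lie_bilin.
by rewrite /transport_coact gK.
Qed.

Definition transport_phm : poissonHopfModule hA N := {|
  phm_comodule := transport_comodule;
  act := transport_act;
  lie := transport_lie;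
  act_bilin := transport_act_bilin;
  act1 := transport_act1;
  actM := transport_actM;
  lie_bilin := transport_lie_bilin;
  lie_poisson := transport_lie_poisson;
  lie_act := transport_lie_act;
  lie_mul := transport_lie_mul;
  coact_act := transport_coact_act;
  coact_lie := transport_coact_lie
|}.

End TransportStructure.

(** * Bijective morphisms are isomorphisms *)

Section InverseMorphism.
Variables (k : fieldType) (G : zmodType) (H : G -> pzAlgType k).
Variables (hH : hopfGCoalg H).
Variables (A : G -> poissonAlgType k) (hA : comodulePoissonAlg hH A).
Variables (M N : G -> lmodType k).
Variables (hM : poissonHopfModule hA M) (hN : poissonHopfModule hA N).
Variables (f : forall a, M a -> N a) (g : forall a, N a -> M a).
Hypotheses (fK : forall a, cancel (@f a) (@g a)) (gK : forall a, cancel (@g a) (@f a)).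

(** Linearity and compatibility of g with the actions are checked after applying the injective f;
    for colinearity m is written as f (g m). *)
Lemma phm_isomorphism_cancel : phm_morphism hM hN f -> phm_isomorphism hM hN f.
Proof.
move=> fM; split=> //; exists g; split=> //; case: fM => fL fact flie fcol.
have fI a : injective (@f a) by exact: can_inj (@fK a).
have gL a : linear (@g a) by move=> c x y; apply: fI; rewrite fL !gK.
split=> // [a x m|a x m|a b m].
- by apply: fI; rewrite fact !gK.
- by apply: fI; rewrite flie !gK.
rewrite -[in RHS](gK m) fcol [RHS]tfold_tmap; last by lin.
rewrite -[LHS]tfold_tens; apply: eq_tfold => u v.
by rewrite fK.
Qed.

End InverseMorphism.

Theorem theorem0p2 (k : fieldType) (G : zmodType)
  (H : G -> pzAlgType k) (hH : hopfGCoalg H) (hS : antipode_bijective hH)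
  (A : G -> poissonAlgType k) (hA : comodulePoissonAlg hH A)
  (M : G -> lmodType k) (hM : poissonHopfModule hA M)
  (phi : forall a, {linear H a -> A a}) (hphi : poisson_central_map hA phi)
  (trivM : trivial_lie' phi hM) (trivA : trivial_lie' phi (regular_phm hA)) :
  (exists hI : poissonHopfModule hA (@induced k G H hH A hA M hM),
     induced_structure hI) /\
  forall hI : poissonHopfModule hA (@induced k G H hH A hA M hM),
    induced_structure hI ->
    phm_isomorphism hI hM (@induced_map k G H hH A hA M hM).
Proof.
pose F a := @induced_map k G H hH A hA M hM a.
pose E a := induced_inv hS hphi trivM (a := a).
have FL a : linear (F a) by exact: induced_map_linear.
have EL a : linear (E a) by exact: induced_inv_linear.
have FK a : cancel (F a) (E a) by exact: induced_mapK.
have EK a : cancel (E a) (F a) by exact: induced_invK.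
have FE a x (m : acoinvType hM a) : F a (itens x m) = act hM x (acoinv_val m).
  exact: induced_mapE.
have Einv a (m : acoinvType hM a) :
    coinv hM (acoinv_val m) /\ Defs.invariant hM (acoinv_val m).
  by case: m => m mP; apply/asboolP.
split.
  (* Existence: the structure of M is carried back along Phi, and the formulas are read off from
     [induced_inv_act]. *)
  pose f a : {linear induced hM a -> M a} :=
    HB.pack (F a) (GRing.isLinear.Build k _ _ *:%R (F a) (FL a)).
  pose g a : {linear M a -> induced hM a} :=
    HB.pack (E a) (GRing.isLinear.Build k _ _ *:%R (E a) (EL a)).
  exists (@transport_phm _ _ _ _ _ _ _ hM _ f g FK EK).
  split=> [a x y m|a x y m|m mF a b x mab ma mabE maE].
  - rewrite /= /transport_act /= FE -actM; exact: induced_inv_act.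
  (* Lie invariance of m removes the second Leibniz term, so x <> (y . m) = {x, y} . m. *)
  - rewrite /= /transport_lie /= FE lie_act (Einv _ m).2.
    by rewrite (lin0 ((act_bilin hM a).2 _)) addr0; exact: induced_inv_act.
  - rewrite /= /transport_coact /= FE coact_act mabE mF.
    have gB : bilin (fun u v => tens (g a u) (v : H b)) by lin.
    rewrite /tmap tfold_tmap2 //; apply: eq_tfold => x0 x1.
    rewrite tfoldE; last first.
      apply: bilinI => [v|u]; last by apply: lin_tens_r; exact: pzmul_bilin.2.
      by apply: (lin_bl _ gB); lin.
    by rewrite [pzmul _ _]mulr1 -maE; congr tens; exact: induced_inv_act.
(* For any structure with the prescribed formulas both sides of each condition are linear, so pure
   tensors suffice. *)
move=> hI [hI1 hI2 hI3]; apply: phm_isomorphism_cancel FK EK _.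
split=> // [a x t|a x t|a b t].
- have L1 : linear (fun t => F a (act hI x t)) by apply: lin_comp; lin.
  have L2 : linear (fun t => act hM x (F a t)) by lin.
  elim/btens_ind: t => [|t t' IH IH'|y m].
  + by rewrite (lin0 L1) (lin0 L2).
  + by rewrite (linD L1) (linD L2); congr (_ + _).
  + by rewrite hI1 !FE actM.
- have L1 : linear (fun t => F a (lie hI x t)) by apply: lin_comp; lin.
  have L2 : linear (fun t => lie hM x (F a t)) by lin.
  elim/btens_ind: t => [|t t' IH IH'|y m].
  + by rewrite (lin0 L1) (lin0 L2).
  + by rewrite (linD L1) (linD L2); congr (_ + _).
  + rewrite hI2 !FE lie_act (Einv _ m).2.
    by rewrite (lin0 ((act_bilin hM a).2 _)) addr0.
- have L1 : linear (fun t => coact hM a b (F _ t)) by lin.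
  have L2 : linear (fun t => tmap (F a) id (coact hI a b t)) by rewrite /tmap; lin.
  elim/btens_ind: t => [|t t' IH IH'|y m].
  + by rewrite (lin0 L1) (lin0 L2).
  + by rewrite (linD L1) (linD L2); congr (_ + _).
  have [[f fF fE] _] := Einv _ m.
  (* The coaction formula requires the a-component of the family to lie in M^{AcoH}_a; its Lie
     invariance is not part of being coinvariant and comes from triviality. *)
  have faP : f a \in @acoinv _ _ _ _ _ _ _ hM a.
    by apply: (coinv_acoinv hS hphi trivM); exists f.
  rewrite FE coact_act -fE fF (hI3 f fF _ _ y m (Acoinv faP)) //.
  rewrite [RHS]tfold_tmap; last by lin.
  rewrite -[LHS]tfold_tens tfold_tmap2; last by lin.
  apply: eq_tfold => x0 x1; rewrite tfoldE.
    by rewrite [pzmul _ _]mulr1 FE.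
  apply: bilinI => [v|u]; last by apply: lin_tens_r; exact: pzmul_bilin.2.
  by lin.
Qed.
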